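(* Let $q\in(0,1]$ and let $n$ be an integer with $n \ge \left\lfloor \frac{|4q-2|}{q}\right\rfloor + 1$. Then, for every choice of the initial labels $\rho:\mathbb{Z}^2\to\{\mathcal{H},\mathcal{V}\}$, the $\mathcal{H}$–$\mathcal{V}$ walk with parameter $q$, with $n$ walkers and with initial labels $\rho$, is recurrent, i.e., almost surely every vertex of $\mathbb{Z}^2$ is visited infinitely many times.
   Context: $\mathcal{H}$–$\mathcal{V}$ walk on $\mathbb{Z}^2$ with parameter $q$ and $n$ walkers: each vertex of $\mathbb{Z}^2$ carries a label $\mathcal{H}$ or $\mathcal{V}$ (initially given by $\rho$), and $n$ walkers (numbered $1,\dots,n$) are initially at the origin $(0,0)$; all walkers share the same labels. At time steps $t=1,2,3,\dots$ the walkers move one at a time in cyclic order: at step $t$ the walker with index $i\in\{1,\dots,n\}$, $i\equiv t \bmod n$, moves. The moving walker first changes the label of its current location $x$ ($\mathcal{H}$ to $\mathcal{V}$, or $\mathcal{V}$ to $\mathcal{H}$) with probability $q$ and keeps it with probability $1-q$, independently of the past. Then, if the new label at $x$ is $\mathcal{H}$ it moves to $x+(1,0)$ or $x-(1,0)$ with probability $\frac12$ each, and if the new label is $\mathcal{V}$ it moves to $x+(0,1)$ or $x-(0,1)$ with probability $\frac12$ each, independently of the past. A vertex is visited infinitely many times if the walkers, taken together, make infinitely many transitions into it. *)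

(* Defs.v *)
From mathcomp Require Import all_boot all_order all_algebra.
From mathcomp Require Import all_classical all_reals all_analysis.

Set Implicit Arguments.
Unset Strict Implicit.
Unset Printing Implicit Defensive.

Import Order.TTheory GRing.Theory Num.Theory.
Local Open Scope classical_set_scope.
Local Open Scope ring_scope.

Notation vertex := (int * int)%type.

Inductive label := LabelH | LabelV.

Definition toggle (l : label) : label :=
  match l with LabelH => LabelV | LabelV => LabelH end.

Definition neighbor (l : label) (plus : bool) (x : vertex) : vertex :=
  let e : int := if plus then 1 else -1 in
  match l with
  | LabelH => (x.1 + e, x.2)
  | LabelV => (x.1, x.2 + e)
  end.

(* Walkers carry the numbers 1, ..., n; the positions attached to the other
   natural numbers are never used. *)
Record state := State { labels : vertex -> label; position : nat -> vertex }.

Definition initial_state (rho : vertex -> label) : state :=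
  State rho (fun _ => (0, 0)).

(* For 1 <= t and 1 <= n, the unique i in {1, ..., n} with i = t mod n. *)
Definition mover (n t : nat) : nat := (t.-1 %% n).+1%N.

Definition step (n t : nat) (flip plus : bool) (s : state) : state :=
  let i := mover n t in
  let x := position s i in
  let l := if flip then toggle (labels s x) else labels s x in
  State (fun y => if y == x then l else labels s y)
        (fun j => if j == i then neighbor l plus x else position s j).

(* The state after the steps 1, ..., t, driven by the choices made at these
   steps; [flip 0] and [plus 0] are not used. *)
Fixpoint hv_walk (n : nat) (rho : vertex -> label) (flip plus : nat -> bool)
    (t : nat) : state :=
  match t with
  | 0%N => initial_state rho
  | t'.+1 => step n t (flip t) (plus t) (hv_walk n rho flip plus t')
  end.

(* The mover of step t always leaves its vertex, so its position after the
   step is the endpoint of a transition. *)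
Definition entry_times (n : nat) (rho : vertex -> label)
    (flip plus : nat -> bool) (v : vertex) : set nat :=
  [set t | (0 < t)%N /\
           position (hv_walk n rho flip plus t) (mover n t) = v].

Definition independent_of d (T : measurableType d) (R : realType)
    (P : probability T R) (A : set T) (G : set (set T)) : Prop :=
  forall B, G B -> P (A `&` B) = (P A * P B)%E.

Definition past d (T : measurableType d) (flip plus : nat -> T -> bool)
    (t : nat) : set (set T) :=
  <<s [set A | exists2 s, (0 < s < t)%N &
         A = [set w | flip s w] \/ A = [set w | plus s w]] >>.

(* [flip t w]: the label is changed at step t; [plus t w]: the mover of step t
   goes in the positive direction of the axis given by the new label.  The
   direction is drawn after the label, so it is independent of [flip t] too. *)
Record hv_choices d (T : measurableType d) (R : realType)
    (P : probability T R) (q : R) (flip plus : nat -> T -> bool) : Prop := {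
  flip_measurable : forall t, (0 < t)%N -> measurable_fun setT (flip t);
  plus_measurable : forall t, (0 < t)%N -> measurable_fun setT (plus t);
  flip_proba : forall t, (0 < t)%N -> P [set w | flip t w] = q%:E;
  plus_proba : forall t, (0 < t)%N -> P [set w | plus t w] = (2^-1)%:E;
  flip_independent : forall t, (0 < t)%N ->
    independent_of P [set w | flip t w] (past flip plus t);
  plus_independent : forall t, (0 < t)%N ->
    independent_of P [set w | plus t w]
      <<s past flip plus t `|` [set [set w | flip t w]] >>
}.

Definition hv_recurrent d (T : measurableType d) (R : realType)
    (P : probability T R) (n : nat) (rho : vertex -> label)
    (flip plus : nat -> T -> bool) : Prop :=
  {ae P, forall w, forall v : vertex,
    infinite_set (entry_times n rho (flip ^~ w) (plus ^~ w) v)}.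

(* Main.v *)
Require Import Defs.
From mathcomp Require Import all_boot all_order all_algebra.
From mathcomp Require Import all_classical all_reals all_analysis.
From mathcomp Require Import ring lra zify.

Set Implicit Arguments.
Unset Strict Implicit.
Unset Printing Implicit Defensive.

Import Order.TTheory GRing.Theory Num.Theory.
Local Open Scope classical_set_scope.
Local Open Scope ring_scope.

(** Fix a vertex [v].  The proof shows that there is an [eps > 0] such that,
    from every reachable state, whatever its labels are, the walkers make a
    departure from [v] during the next [T] steps with probability at least
    [eps], where [T] depends only on how far the walkers are from [v].  Iterating
    over consecutive blocks of steps gives infinitely many departures from [v]
    almost surely, and a walker that leaves [v] at a step later than [n] had
    entered it at its previous move, [n] steps before.

    The estimate on one block comes from a supermartingale.  The function
    [a x = ln |x|^2 - 2 / |x|^2], with the value [-20] at the origin, is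
    superharmonic off the origin ([superharmonic]).  A step of the H-V walk is
    not a step of the simple random walk: it moves along one axis only, and the
    mean increment of [a] is then about [+ g x] or [- g x], where [g x] is half
    the second difference of [a] in the horizontal direction.  This bias is
    absorbed by giving the label V at [x] the weight [(2 q - 1) / q * g x] and
    the label H the weight [0]: the sum of [a (X_i - v)] over the walkers plus
    the change of the total label weight, which is called [energy] below, is a
    supermartingale until a walker leaves [v] ([drift_le0], [expect_stopped]).

    Compare the two parts of the energy over [T = L^2] steps.  The function
    [g] decays like [|x^2 - y^2| / |x|^4], whose sum over the box of side [2 L + 1]
    is [4 ln L] up to a constant ([box_sum]); at most [L^2] sites are visited,
    and those outside the box contribute [O(L^-2)] each.  So the label weight is
    at least [- (|4 q - 2| / q) ln T - C] ([correction_ge]).  On the other hand,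
    for most of the times before [T] most walkers are at a distance of order
    [sqrt T], where [a] is [ln T] up to a constant.  This holds
    whatever the labels do, because [spread], a function that is convex along
    both axes, grows in mean whenever a walker is near [v] ([occupation]).

    If no walker left [v] before [T] with probability [p], the mean energy would
    thus be at least about [(p n - |4 q - 2| / q) ln T], while it is at most its
    initial value, which does not depend on [T].  Hence [p] is at most about
    [|4 q - 2| / (q n)], which is smaller than [1] ([quiet_block]).

    All expectations are finite sums over the outcomes of finitely many coins;
    [proba_hist] identifies them with probabilities in the given space. *)

#[local] Arguments step : simpl never.

(** * A superharmonic function with logarithmic growth *)

Section Potential.
Variable R : realType.
Implicit Types (x : vertex) (l : label) (g : vertex -> R).

Definition sqnorm x : R := x.1%:~R ^+ 2 + x.2%:~R ^+ 2.

(** The term [- 2 / t] makes the function strictly superharmonic: the discrete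
    Laplacian of [ln |x|^2] alone is positive, of order [|x|^-4], near the
    diagonals. *)
Definition radial (t : R) : R := ln t - 2 / t.

(** At the origin [radial] has no useful value; any constant that is negative
    enough keeps the function superharmonic at the four neighbors of the
    origin. *)
Definition potential x : R := if x == 0 then -20 else radial (sqnorm x).

(** The mean increment of [g] when the mover leaves [x] along the axis of [l]. *)
Definition sdiff g l x : R :=
  (g (neighbor l true x) + g (neighbor l false x)) / 2 - g x.

Lemma sqnorm_nat x : sqnorm x = (`|x.1| ^ 2 + `|x.2| ^ 2)%N%:R.
Proof.
have h (z : int) : (`|z| ^ 2)%N%:R = z%:~R ^+ 2 :> R.
  by rewrite natrX natr_absz intr_norm real_normK ?num_real.
by rewrite natrD !h.
Qed.

Lemma sqnorm_ge1 x : x != 0 -> 1 <= sqnorm x.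
Proof.
move=> x0; rewrite sqnorm_nat ler1n addn_gt0 !expn_gt0 !absz_gt0 /=.
rewrite !orbF; move: x0; case: x => a b /=; apply: contraNT.
by rewrite negb_or !negbK => /andP[/eqP -> /eqP ->].
Qed.

Lemma sqnorm1_or_ge2 x : x != 0 -> sqnorm x = 1 \/ 2 <= sqnorm x.
Proof.
move=> /sqnorm_ge1; rewrite sqnorm_nat ler1n => h.
have [h2|h2] := leqP 2 (`|x.1| ^ 2 + `|x.2| ^ 2)%N.
  by right; rewrite (ler_nat _ 2).
by left; apply/eqP; rewrite -[1]/(1%:R) eqr_nat eqn_leq h -ltnS h2.
Qed.

Lemma sqnorm0 : sqnorm 0 = 0.
Proof. by rewrite /sqnorm /= !expr0n /= addr0. Qed.

Lemma potential_ge x : -20 <= potential x.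
Proof.
rewrite /potential /radial; case: eqP => // /eqP /sqnorm_ge1 s1.
have : 2 / sqnorm x <= 2 by rewrite ler_pdivrMr; lra.
have := ln_ge0 s1; lra.
Qed.

Lemma potential_le x : x != 0 -> potential x <= ln (sqnorm x).
Proof.
move=> x0; rewrite /potential /radial (negbTE x0).
have : 0 <= 2 / sqnorm x by rewrite divr_ge0 // (le_trans _ (sqnorm_ge1 x0)).
lra.
Qed.

Lemma ln_le_sub1 (y : R) : 0 < y -> ln y <= y - 1.
Proof. by move=> y0; have := @le_ln1Dx R (y - 1); rewrite subrKC; apply; lra. Qed.

Lemma neighbor_sqnorm_gt0 (X Y s : R) : s = X ^+ 2 + Y ^+ 2 -> 2 <= s ->
  0 < (X + 1) ^+ 2 + Y ^+ 2 /\ 0 < (X - 1) ^+ 2 + Y ^+ 2.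
Proof. move=> es s2; split; nra. Qed.

(** The four logarithms combine into the logarithm of the product [p] of the
    squared norms of the neighbors, and [p = (s^2 - 1)^2 + 16 X^2 Y^2] exceeds
    [s^4] by at most [2 s^2 + 1].  The inverses of the four norms add up to
    [4 (s + 1) (s^2 + 1) / p], and the gain that this gives over [4 / s] is
    larger as soon as [2 <= s]. *)
Lemma superharmonic_radial (X Y s : R) : s = X ^+ 2 + Y ^+ 2 -> 2 <= s ->
  ((radial ((X + 1) ^+ 2 + Y ^+ 2) + radial ((X - 1) ^+ 2 + Y ^+ 2)) / 2 - radial s) +
  ((radial (X ^+ 2 + (Y + 1) ^+ 2) + radial (X ^+ 2 + (Y - 1) ^+ 2)) / 2 - radial s) <= 0.
Proof.
move=> es s2.
have [p1 p2] := neighbor_sqnorm_gt0 es s2.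
have [] := @neighbor_sqnorm_gt0 Y X s _ s2; first by rewrite addrC.
rewrite ![_ + X ^+ 2]addrC => p3 p4.
set b1 := (X + 1) ^+ 2 + Y ^+ 2 in p1 *.
set b2 := (X - 1) ^+ 2 + Y ^+ 2 in p2 *.
set b3 := X ^+ 2 + (Y + 1) ^+ 2 in p3 *.
set b4 := X ^+ 2 + (Y - 1) ^+ 2 in p4 *.
have s0 : 0 < s by lra.
set w := X ^+ 2 * Y ^+ 2.
have ew : b1 * b2 * (b3 * b4) = (s ^+ 2 - 1) ^+ 2 + 16 * w.
  by rewrite es /b1 /b2 /b3 /b4 /w; ring.
have w0 : 0 <= w by rewrite mulr_ge0 ?sqr_ge0.
have w4 : 4 * w <= s ^+ 2 by rewrite es /w; have := sqr_ge0 (X ^+ 2 - Y ^+ 2); rewrite sqrrB; lra.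
set p := b1 * b2 * (b3 * b4) in ew.
have p0 : 0 < p by rewrite !mulr_gt0.
have ple : p <= (s ^+ 2 + 1) ^+ 2 by rewrite ew; nra.
have lp : ln p = ln b1 + ln b2 + (ln b3 + ln b4).
  by rewrite /p !lnM ?posrE ?mulr_gt0.
have einv : b1^-1 + b2^-1 + (b3^-1 + b4^-1) = 4 * (s + 1) * (s ^+ 2 + 1) / p.
  have -> : 4 * (s + 1) * (s ^+ 2 + 1) = (b1 + b2) * (b3 * b4) + (b3 + b4) * (b1 * b2).
    by rewrite es /b1 /b2 /b3 /b4; ring.
  rewrite /p; field; by rewrite !gt_eqF.
have inv_ge : 4 * (s + 1) / (s ^+ 2 + 1) <= 4 * (s + 1) * (s ^+ 2 + 1) / p.
  rewrite ler_pdivlMr // mulrAC ler_pdivrMr; last by nra.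
  rewrite -[leRHS]mulrA -expr2 ler_wpM2l //; lra.
have lnle : ln p - 4 * ln s <= (2 * s ^+ 2 + 1) / s ^+ 4.
  have s40 : 0 < s ^+ 4 by rewrite exprn_gt0.
  have -> : 4 * ln s = ln (s ^+ 4) by rewrite lnXn // mulr_natl.
  rewrite -ln_div ?posrE //; apply: le_trans (ln_le_sub1 _) _; first by rewrite divr_gt0.
  rewrite -[X in _ - X](@divff _ (s ^+ 4)) ?gt_eqF // -mulrBl.
  rewrite ler_pM2r ?invr_gt0 //; rewrite ew; nra.
have key : (2 * s ^+ 2 + 1) / s ^+ 4 <= 2 * (4 * (s + 1) / (s ^+ 2 + 1) - 4 / s).
  have -> : 2 * (4 * (s + 1) / (s ^+ 2 + 1) - 4 / s) = 8 * (s - 1) * s ^+ 3 / (s ^+ 4 * (s ^+ 2 + 1)).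
    by field; rewrite !gt_eqF //; nra.
  have -> : (2 * s ^+ 2 + 1) / s ^+ 4 = (2 * s ^+ 2 + 1) * (s ^+ 2 + 1) / (s ^+ 4 * (s ^+ 2 + 1)).
    by field; rewrite !gt_eqF //; nra.
  rewrite ler_pM2r ?invr_gt0 ?mulr_gt0 ?exprn_gt0 //; last by nra.
  have -> : 8 * (s - 1) * s ^+ 3 = 8 * s ^+ 4 - 8 * s ^+ 3 by ring.
  have -> : (2 * s ^+ 2 + 1) * (s ^+ 2 + 1) = 2 * s ^+ 4 + 3 * s ^+ 2 + 1 by ring.
  have h3 : s ^+ 4 >= 2 * s ^+ 3 by rewrite [s ^+ 4]exprS ler_wpM2r // exprn_ge0 // ltW.
  have h2 : s ^+ 3 >= 2 * s ^+ 2 by rewrite [s ^+ 3]exprS ler_wpM2r // exprn_ge0 // ltW.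
  nra.
rewrite /radial; move: einv inv_ge lnle key lp.
move: (b1^-1) (b2^-1) (b3^-1) (b4^-1) (ln b1) (ln b2) (ln b3) (ln b4).
move: (ln p) (ln s) (s^-1); move=> *; lra.
Qed.

(** The product of the squared norms of the two neighbors is [s^2 + u] with
    [u = 2 (Y^2 - X^2) + 1], so that the logarithmic part is
    [(Y^2 - X^2) / s^2] up to a multiple of [s^-2]; the other terms are of
    order [s^-2]. *)
Lemma sdiff_radial_bound (X Y s : R) : s = X ^+ 2 + Y ^+ 2 -> 2 <= s ->
  `|(radial ((X + 1) ^+ 2 + Y ^+ 2) + radial ((X - 1) ^+ 2 + Y ^+ 2)) / 2 - radial s| <=
  `|X ^+ 2 - Y ^+ 2| / s ^+ 2 + 100 / s ^+ 2.
Proof.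
move=> es s2.
have [p1 p2] := neighbor_sqnorm_gt0 es s2.
set b1 := (X + 1) ^+ 2 + Y ^+ 2 in p1 *.
set b2 := (X - 1) ^+ 2 + Y ^+ 2 in p2 *.
have s0 : 0 < s by lra.
have X0 : 0 <= X ^+ 2 := sqr_ge0 X.
have Xs : X ^+ 2 <= s by rewrite es; have := sqr_ge0 Y; lra.
set p := b1 * b2.
have p0 : 0 < p by rewrite mulr_gt0.
have ep : p = s ^+ 2 + (2 * s + 1 - 4 * X ^+ 2) by rewrite /p /b1 /b2 es; ring.
have pge : s ^+ 2 / 4 <= p by rewrite ep; nra.
have s20 : 0 < s ^+ 2 by rewrite exprn_gt0.
have is2 : 0 < (s ^+ 2)^-1 by rewrite invr_gt0.
have ip : 0 < p^-1 by rewrite invr_gt0.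
have ip4 : p^-1 <= 4 * (s ^+ 2)^-1.
  have := pge; rewrite -ler_pV2 ?inE ?unitfE ?gt_eqF ?divr_gt0 //=.
  by rewrite invf_div.
have lp : ln p = ln b1 + ln b2 by rewrite /p lnM ?posrE.
pose u := 2 * s + 1 - 4 * X ^+ 2.
have u_le : `|u| <= 3 * s by rewrite ler_norml /u; apply/andP; split; nra.
have up : ln p - 2 * ln s <= u / s ^+ 2.
  have -> : 2 * ln s = ln (s ^+ 2) by rewrite lnXn // mulr_natl.
  rewrite -ln_div ?posrE //; apply: le_trans (ln_le_sub1 _) _; first by rewrite divr_gt0.
  by rewrite ep -/u mulrDl divff ?gt_eqF // addrAC subrr add0r.
have low : 2 * ln s - ln p <= - u / p.
  have -> : 2 * ln s = ln (s ^+ 2) by rewrite lnXn // mulr_natl.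
  rewrite -ln_div ?posrE //; apply: le_trans (ln_le_sub1 _) _; first by rewrite divr_gt0.
  have -> : s ^+ 2 = p - u by rewrite ep /u; ring.
  by rewrite mulrBl divff ?gt_eqF // mulNr addrAC subrr add0r.
have low2 : - u / p <= - u / s ^+ 2 + 36 / s ^+ 2.
  have -> : - u / p = - u / s ^+ 2 + u ^+ 2 / p / s ^+ 2.
    have -> : u = p - s ^+ 2 by rewrite ep /u; ring.
    by field; rewrite !gt_eqF.
  rewrite lerD2l ler_pM2r // ler_pdivrMr //.
  have : u ^+ 2 <= (3 * s) ^+ 2 by rewrite -[u ^+ 2]real_normK ?num_real // lerXn2r // nnegrE; lra.
  rewrite exprMn; lra.
have eb : b1^-1 + b2^-1 - 2 / s = 2 * (4 * X ^+ 2 - s - 1) / s / p.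
  have e : 4 * X ^+ 2 - s - 1 = s * (s + 1) - p by rewrite ep; ring.
  rewrite e; have -> : s * (s + 1) = s * (b1 + b2) / 2 by rewrite /b1 /b2 es; field.
  by rewrite /p; field; rewrite !gt_eqF.
have ebn : `|b1^-1 + b2^-1 - 2 / s| <= 32 / s ^+ 2.
  rewrite eb normrM [`|p^-1|]gtr0_norm //.
  have h1 : `|2 * (4 * X ^+ 2 - s - 1) / s| <= 8.
    rewrite normrM normfV (gtr0_norm s0) ler_pdivrMr // normrM ger0_norm //.
    have : `|4 * X ^+ 2 - s - 1| <= 4 * s by rewrite ler_norml; apply/andP; split; lra.
    lra.
  apply: le_trans (ler_wpM2r (ltW ip) h1) _.
  lra.
have eu : u / s ^+ 2 = 2 * ((Y ^+ 2 - X ^+ 2) / s ^+ 2) + (s ^+ 2)^-1.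
  by rewrite /u es; field; rewrite -es gt_eqF.
have nG : `|(X ^+ 2 - Y ^+ 2) / s ^+ 2| = `|X ^+ 2 - Y ^+ 2| / s ^+ 2.
  by rewrite normrM [`|_^-1|]gtr0_norm.
rewrite -nG.
have nG1 := ler_norm ((X ^+ 2 - Y ^+ 2) / s ^+ 2).
have nG2 := ler_norm (- ((X ^+ 2 - Y ^+ 2) / s ^+ 2)).
rewrite normrN in nG2.
have eG : (Y ^+ 2 - X ^+ 2) / s ^+ 2 = - ((X ^+ 2 - Y ^+ 2) / s ^+ 2) by ring.
move: ebn; rewrite ler_norml => /andP[e1 e2].
rewrite ler_norml /radial; rewrite !mulNr eu eG in low2; rewrite mulNr in low; rewrite eu eG in up.
rewrite lp in up low.
move: low2 up low e1 e2 nG1 nG2 is2.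
move: (ln b1) (ln b2) (ln s) (b1^-1) (b2^-1) (s^-1) ((s ^+ 2)^-1) => A B C D E' F G.
move: ((X ^+ 2 - Y ^+ 2) * G) (u / p) => J K *.
apply/andP; split; lra.
Qed.

(** The coordinate along the axis of [l] comes first, so that one computation
    serves both axes. *)
Definition coord l x : R * R :=
  match l with LabelH => (x.1%:~R, x.2%:~R) | LabelV => (x.2%:~R, x.1%:~R) end.

Lemma sqnorm_neighbor l b x :
  sqnorm (neighbor l b x) =
  ((coord l x).1 + (if b then 1 else -1)) ^+ 2 + (coord l x).2 ^+ 2.
Proof.
by case: l b => [] [] /=; rewrite /sqnorm /= rmorphD /= ?rmorphN1 // addrC.
Qed.

Lemma sqnorm_coord l x : sqnorm x = (coord l x).1 ^+ 2 + (coord l x).2 ^+ 2.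
Proof. by case: l; rewrite // addrC. Qed.

Lemma potential_radial x : x != 0 -> potential x = radial (sqnorm x).
Proof. by rewrite /potential => /negbTE ->. Qed.

Lemma sqnorm_neq0 x : 0 < sqnorm x -> x != 0.
Proof. by apply: contraTneq => ->; rewrite sqnorm0 ltxx. Qed.

Lemma sdiff_potential l x : 2 <= sqnorm x ->
  let X := (coord l x).1 in let Y := (coord l x).2 in
  sdiff potential l x =
  (radial ((X + 1) ^+ 2 + Y ^+ 2) + radial ((X - 1) ^+ 2 + Y ^+ 2)) / 2
  - radial (sqnorm x).
Proof.
move=> s2 X Y.
have [p1 p2] := neighbor_sqnorm_gt0 (sqnorm_coord l x) s2.
rewrite /sdiff !potential_radial ?sqnorm_neighbor //; apply: sqnorm_neq0.
- exact: lt_le_trans s2.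
- by rewrite sqnorm_neighbor.
- by rewrite sqnorm_neighbor.
Qed.

Lemma sqnorm1P x : sqnorm x = 1 -> x \in [:: (1, 0); (-1, 0); (0, 1); (0, -1)].
Proof.
rewrite sqnorm_nat; case: x => x y /=.
rewrite -[1]/(1%:R) => /eqP; rewrite eqr_nat => /eqP.
rewrite !inE !xpair_eqE; nia.
Qed.

Lemma potential_nat x :
  potential x = let k := (`|x.1| ^ 2 + `|x.2| ^ 2)%N in
                if k == 0%N then -20 else radial k%:R.
Proof.
case: (eqVneq x 0) => [->|x0]; first by rewrite /potential eqxx.
rewrite potential_radial // sqnorm_nat /=; case: eqP => // k0.
by have := sqnorm_ge1 x0; rewrite sqnorm_nat k0 ler10.
Qed.

(** At the four neighbors of the origin, one of the two axes runs through the
    origin, where the value of [potential] is conventional. *)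
Lemma sdiff_potential_unit x : sqnorm x = 1 ->
  let c1 := (radial 4 - 20) / 2 - radial 1 in
  let c2 := radial 2 - radial 1 in
  sdiff potential LabelH x = c1 /\ sdiff potential LabelV x = c2 \/
  sdiff potential LabelH x = c2 /\ sdiff potential LabelV x = c1.
Proof.
move=> /sqnorm1P.
by rewrite !inE => /or4P[] /eqP ->; rewrite /sdiff !potential_nat /=;
  [left|left|right|right]; split; lra.
Qed.

Lemma radial_124 : radial 1 = -2 /\ `|radial 2| <= 1 /\ `|radial 4| <= 3.
Proof.
have l2 : 0 <= ln (2 : R) by rewrite ln_ge0 ?ler1n.
have l4 : 0 <= ln (4 : R) by rewrite ln_ge0 ?ler1n.
have := @ln_le_sub1 2; have := @ln_le_sub1 4; rewrite /radial ln1 !ler_norml.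
move=> h4 h2; rewrite !ltr0n in h4 h2.
have {}h4 := h4 isT; have {}h2 := h2 isT.
by split; [lra | split; apply/andP; split; lra].
Qed.

Lemma superharmonic x : x != 0 ->
  sdiff potential LabelH x + sdiff potential LabelV x <= 0.
Proof.
have [e1 [e2 e4]] := radial_124.
rewrite ler_norml in e2; rewrite ler_norml in e4.
move: e2 e4 => /andP[e2 e2'] /andP[e4 e4'].
move=> /sqnorm1_or_ge2[/sdiff_potential_unit[] [-> ->]|s2]; [lra|lra|].
rewrite !sdiff_potential //=; have := superharmonic_radial (erefl (sqnorm x)) s2.
by rewrite [_%:~R ^+ 2 + (_ + 1) ^+ 2]addrC [_%:~R ^+ 2 + (_ - 1) ^+ 2]addrC.
Qed.

Lemma sdiff_potential_bound x : x != 0 ->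
  `|sdiff potential LabelH x| <=
  (`|x.1%:~R ^+ 2 - x.2%:~R ^+ 2| + 100) / sqnorm x ^+ 2.
Proof.
have [e1 [e2 e4]] := radial_124.
rewrite ler_norml in e2; rewrite ler_norml in e4.
move: e2 e4 => /andP[e2 e2'] /andP[e4 e4'].
move=> /sqnorm1_or_ge2[s1|s2]; last first.
  by rewrite sdiff_potential //= [leRHS]mulrDl; apply: sdiff_radial_bound.
rewrite s1 expr1n divr1; apply: (@le_trans _ _ 100); last by rewrite lerDr.
by case: (sdiff_potential_unit s1) => -[-> _]; rewrite ler_norml; apply/andP; split; lra.
Qed.

End Potential.

(** * The second differences of the potential, summed over a box *)

Fixpoint irange (L : nat) : seq int :=
  if L is L'.+1 then L%:Z :: - L%:Z :: irange L' else [:: 0].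

Lemma mem_irange L (z : int) : (z \in irange L) = (`|z| <= L)%N.
Proof.
elim: L => [|L IH]; first by rewrite inE leqn0 absz_eq0.
by rewrite !inE IH; lia.
Qed.

Lemma uniq_irange L : uniq (irange L).
Proof.
elim: L => [//|L IH]; rewrite cons_uniq cons_uniq IH inE !mem_irange.
by apply/and3P; split=> //; lia.
Qed.

Definition box (L : nat) : seq vertex := [seq (x, y) | x <- irange L, y <- irange L].

Lemma uniq_box L : uniq (box L).
Proof. by apply: allpairs_uniq (uniq_irange L) (uniq_irange L) _ => -[? ?] [? ?] _ _ [-> ->]. Qed.

Lemma mem_box L (x : vertex) : (x \in box L) = (`|x.1| <= L)%N && (`|x.2| <= L)%N.
Proof.
rewrite -!mem_irange; apply/allpairsP/andP => [[[a b] /= [ha hb ->]] //|[ha hb]].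
by exists x; split=> //; case: x {ha hb}.
Qed.

Section LatticeSum.
Variable R : realType.

Lemma sum_irange (f : nat -> R) L :
  \sum_(z <- irange L) f `|z|%N = f 0%N + 2 * \sum_(1 <= k < L.+1) f k.
Proof.
elim: L => [|L IH].
  by rewrite big_nil mulr0 addr0 big_seq1.
rewrite big_nat_recr //= !big_cons IH abszN /= mulrDr; lra.
Qed.

(** The bound of [sdiff_potential_bound] at a vertex whose coordinates have the
    absolute values [m] and [k]; it is [0] at the origin. *)
Definition cell (m k : nat) : R :=
  (`|m%:R ^+ 2 - k%:R ^+ 2| + 100) / (m%:R ^+ 2 + k%:R ^+ 2) ^+ 2.

Lemma cell_ge0 m k : 0 <= cell m k.
Proof. by rewrite divr_ge0 ?sqr_ge0 // addr_ge0. Qed.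

Lemma cellC m k : cell m k = cell k m.
Proof. by rewrite /cell distrC addrC [_ ^+ 2 + _]addrC. Qed.

(** [y / (m^2 + y^2)] is a primitive of [(m^2 - y^2) / (m^2 + y^2)^2], which is
    decreasing in [y] on the interval from [0] to [m]. *)
Lemma cell_telescope (m k : nat) : (0 < m)%N -> (0 < k <= m)%N ->
  cell m k <= (k%:R / (m%:R ^+ 2 + k%:R ^+ 2)
               - k.-1%:R / (m%:R ^+ 2 + k.-1%:R ^+ 2)) + 100 / m%:R ^+ 4.
Proof.
case: k => // k m0 /andP[_ km] /=; rewrite /cell mulrDl.
have M0 : 0 < m%:R :> R by rewrite ltr0n.
have KM : k.+1%:R <= m%:R :> R by rewrite ler_nat.
have K0 : 0 <= k%:R :> R by rewrite ler0n.
rewrite -natr1 in KM *.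
move: (m%:R) (k%:R) M0 KM K0 => M K M0 KM K0.
have A0 : 0 < M ^+ 2 + (K + 1) ^+ 2 by nra.
have B0 : 0 < M ^+ 2 + K ^+ 2 by nra.
have M20 : 0 < M ^+ 2 by rewrite exprn_gt0.
apply: lerD.
  have -> : (K + 1) / (M ^+ 2 + (K + 1) ^+ 2) - K / (M ^+ 2 + K ^+ 2) =
     (M ^+ 2 - K * (K + 1)) / ((M ^+ 2 + (K + 1) ^+ 2) * (M ^+ 2 + K ^+ 2)).
    by field; rewrite !gt_eqF.
  rewrite ger0_norm; last by nra.
  rewrite ler_pdivrMr ?exprn_gt0 // mulrAC ler_pdivlMr ?mulr_gt0 //.
  rewrite [(_ + (K + 1) ^+ 2) ^+ 2]expr2.
  set A := M ^+ 2 + (K + 1) ^+ 2; set B := M ^+ 2 + K ^+ 2.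
  have h1 : M ^+ 2 - (K + 1) ^+ 2 <= M ^+ 2 - K * (K + 1) by nra.
  have BA : B <= A by rewrite /A /B; nra.
  have h2 : A * B <= A * A by rewrite ler_pM2l.
  have h3 : 0 <= M ^+ 2 - (K + 1) ^+ 2 by nra.
  by apply: ler_pM => //; rewrite mulr_ge0 // ltW.
rewrite ler_pM2l // lef_pV2 ?posrE ?exprn_gt0 //.
have -> : M ^+ 4 = (M ^+ 2) ^+ 2 by rewrite -exprM.
by rewrite lerXn2r ?nnegrE ?ltW //; nra.
Qed.

(** The telescoping sum leaves [m / (m^2 + m^2)]. *)
Lemma row_sum (m : nat) : (0 < m)%N ->
  \sum_(1 <= k < m.+1) cell m k <= 1 / 2 / m%:R + 100 / m%:R ^+ 3.
Proof.
move=> m0; have M0 : 0 < m%:R :> R by rewrite ltr0n.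
pose G (j : nat) : R := j%:R / (m%:R ^+ 2 + j%:R ^+ 2).
suff h j : (j <= m)%N -> \sum_(1 <= k < j.+1) cell m k <=
    G j + j%:R * (100 / m%:R ^+ 4).
  apply: le_trans (h m (leqnn m)) _; rewrite /G.
  by rewrite le_eqVlt; apply/orP; left; apply/eqP; field; rewrite gt_eqF //; nra.
elim: j => [|j IH] jm; first by rewrite big_nil /G !mul0r addr0.
rewrite big_nat_recr //=.
have h1 := IH (ltnW jm).
have h2 := @cell_telescope m j.+1 m0 jm; rewrite -/(G j.+1) -/(G _) /= in h2.
rewrite -[j.+1%:R]natr1 mulrDl.
lra.
Qed.

Lemma harmonic_le (L : nat) : (0 < L)%N ->
  \sum_(1 <= m < L.+1) (m%:R)^-1 <= 1 + ln (L%:R : R).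
Proof.
elim: L => // -[_ _|L IH _]; first by rewrite big_nat1 ln1 invr1 addr0.
rewrite big_nat_recr //=; have {}IH := IH isT.
set x : R := L.+2%:R.
have x0 : 0 < x by rewrite ltr0n.
have L0 : 0 < L.+1%:R :> R by rewrite ltr0n.
have e : L.+1%:R = x - 1 :> R by rewrite /x -[L.+2%:R]natr1 addrK.
clearbody x.
have : ln (L.+1%:R / x) <= - x^-1.
  have q0 : 0 < L.+1%:R / x by rewrite divr_gt0.
  have := @le_ln1Dx R (L.+1%:R / x - 1); rewrite subrKC => h.
  have e2 : L.+1%:R / x = 1 - x^-1 by rewrite e mulrBl divff ?gt_eqF // mul1r.
  rewrite e2 in q0 h *. move: (x^-1) q0 h => i q0 h; apply: le_trans (h _) _; lra.
rewrite ln_div ?posrE //; move: (x^-1) => i; lra.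
Qed.

Lemma sum_inv_sqr_le (L : nat) : \sum_(1 <= m < L.+1) (m%:R ^+ 2)^-1 <= (2 : R).
Proof.
case: L => [|L]; first by rewrite big_nil.
suff : \sum_(1 <= m < L.+2) (m%:R ^+ 2)^-1 <= (2 : R) - (L.+1%:R)^-1.
  have : 0 < (L.+1%:R : R)^-1 by rewrite invr_gt0 ltr0n.
  by move: (L.+1%:R^-1) => i; lra.
elim: L => [|L IH]; first by rewrite big_nat1 expr1n invr1; lra.
rewrite big_nat_recr //=; apply: le_trans (lerD IH (lexx _)) _.
rewrite -[L.+2%:R]natr1; set x : R := L.+1%:R.
have x0 : 0 < x by rewrite ltr0n.
clearbody x.
have h : ((x + 1) ^+ 2)^-1 <= (x * (x + 1))^-1.
  by rewrite lef_pV2 ?posrE ?exprn_gt0 ?mulr_gt0 //; nra.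
have e : (x * (x + 1))^-1 = x^-1 - (x + 1)^-1.
  by field; rewrite !gt_eqF //; lra.
move: h; rewrite e; move: (x^-1) ((x + 1)^-1) => i j; lra.
Qed.

(** By symmetry it is enough to sum over the vertices with [|y| <= |x|].  The
    column of abscissa [x = m] or [x = - m] then contributes
    [1 / m + O(1 / m^2)].  The factor [4] in front of the logarithm is what makes the
    threshold on [n] come out as [|4 q - 2| / q]. *)
Lemma box_sum (L : nat) : (0 < L)%N ->
  \sum_(x <- box L) cell `|x.1| `|x.2| <= 4 * ln (L%:R : R) + 2412.
Proof.
move=> L0; rewrite big_allpairs /=.
(* The diagonal is counted in both halves, which is harmless for an upper bound. *)
pose half := \sum_(x <- irange L) \sum_(y <- irange L | (`|y| <= `|x|)%N) cell `|x| `|y|.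
have le_half : \sum_(x <- irange L) \sum_(y <- irange L) cell `|x| `|y| <= half + half.
  have e : half = \sum_(x <- irange L) \sum_(y <- irange L | (`|x| <= `|y|)%N) cell `|x| `|y|.
    rewrite /half (exchange_big_dep predT) //=.
    by apply: eq_bigr => x _; apply: eq_bigr => y _; rewrite cellC.
  rewrite {2}e -big_split /=; apply: ler_sum => x _.
  rewrite [X in X + _]big_mkcond [X in _ + X]big_mkcond -big_split /=.
  apply: ler_sum => y _; have := cell_ge0 `|x| `|y|.
  by case: leqP => h; case: leqP => h'; rewrite ?addr0 ?add0r ?lerDl //; lia.
have row (m : nat) : (m <= L)%N ->
  \sum_(y <- irange L | (`|y| <= m)%N) cell m `|y| <=
  (if m == 0%N then 0 else (m%:R)^-1 + 301 * (m%:R ^+ 2)^-1).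
  move=> mL; rewrite big_mkcond /=.
  rewrite (@sum_irange (fun k => if (k <= m)%N then cell m k else 0)) /=.
  rewrite -big_mkcond /=.
  have -> : \sum_(1 <= k < L.+1 | (k <= m)%N) cell m k = \sum_(1 <= k < m.+1) cell m k.
    by rewrite (@big_nat_widen _ _ _ 1 m.+1 L.+1).
  case: eqP => [->|/eqP]; first by rewrite big_nil mulr0 addr0 /cell /= expr0n /= addr0 expr0n /= invr0 mulr0.
  rewrite -lt0n => m0; have := row_sum m0.
  have M1 : 1 <= m%:R :> R by rewrite ler1n.
  rewrite /cell expr0n /= subr0 addr0.
  move: (m%:R) M1 => M M1 h; have M0 : 0 < M by lra.
  rewrite ger0_norm ?sqr_ge0 // mulrDl.
  have -> : M ^+ 2 / M ^+ 2 ^+ 2 = (M ^+ 2)^-1 by field; rewrite gt_eqF.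
  have i2 : 0 < (M ^+ 2)^-1 by rewrite invr_gt0 exprn_gt0.
  have h4 : ((M ^+ 2) ^+ 2)^-1 <= (M ^+ 2)^-1.
    by rewrite lef_pV2 ?posrE ?exprn_gt0 // ler_eXnr // exprn_ege1.
  have h3 : (M ^+ 3)^-1 <= (M ^+ 2)^-1.
    by rewrite lef_pV2 ?posrE ?exprn_gt0 // [M ^+ 3]exprS ler_peMl // exprn_ge0 // ltW.
  lra.
apply: le_trans le_half _.
have : half <= 2 * (\sum_(1 <= m < L.+1) (m%:R)^-1 + 301 * \sum_(1 <= m < L.+1) (m%:R ^+ 2)^-1).
  pose B m : R := if m == 0%N then 0 else (m%:R)^-1 + 301 * (m%:R ^+ 2)^-1.
  apply: (@le_trans _ _ (\sum_(x <- irange L) B `|x|%N)).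
    rewrite /half big_seq [leRHS]big_seq; apply: ler_sum => x.
    by rewrite mem_irange => /row.
  rewrite sum_irange /= add0r.
  rewrite ler_pM2l // mulr_sumr -big_split /= le_eqVlt; apply/orP; left; apply/eqP.
  by apply: eq_big_nat => m /andP[m1 _]; rewrite /B gtn_eqF.
have := harmonic_le L0; have := sum_inv_sqr_le L; lra.
Qed.

End LatticeSum.

Section Gap.
Variable R : realType.

Definition gap (x : vertex) : R :=
  if x == 0 then 0 else sdiff (@potential R) LabelH x.

Lemma sqr_absz (z : int) : (`|z|%N%:R : R) ^+ 2 = z%:~R ^+ 2.
Proof. by rewrite natr_absz intr_norm real_normK ?num_real. Qed.

Lemma gap_le_cell x : `|gap x| <= cell R `|x.1| `|x.2|.
Proof.
rewrite /gap; case: eqVneq => [_|x0]; first by rewrite normr0 cell_ge0.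
by rewrite /cell !sqr_absz; apply: sdiff_potential_bound.
Qed.

Lemma sqnorm_outside_box L x : x \notin box L -> L%:R ^+ 2 <= sqnorm R x.
Proof.
rewrite sqnorm_nat -natrX ler_nat mem_box negb_and -!ltnNge => /orP[] /ltnW h.
  by apply: leq_trans (leq_addr _ _); rewrite leq_exp2r.
by apply: leq_trans (leq_addl _ _); rewrite leq_exp2r.
Qed.

Lemma gap_far x L : (0 < L)%N -> x \notin box L -> `|gap x| <= 101 / L%:R ^+ 2.
Proof.
move=> L0 xL.
have LR : 0 < L%:R ^+ 2 :> R by rewrite exprn_gt0 ?ltr0n.
have sL : L%:R ^+ 2 <= sqnorm R x := sqnorm_outside_box xL.
have s0 : 0 < sqnorm R x := lt_le_trans LR sL.
have x0 := sqnorm_neq0 s0.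
have s1 := @sqnorm_ge1 R x x0.
rewrite /gap (negbTE x0); apply: le_trans (sdiff_potential_bound R x0) _.
have h : `|x.1%:~R ^+ 2 - x.2%:~R ^+ 2| <= sqnorm R x.
  rewrite ler_norml /sqnorm; have := sqr_ge0 (x.1%:~R : R); have := sqr_ge0 (x.2%:~R : R).
  by move=> ? ?; apply/andP; split; lra.
apply: (@le_trans _ _ (101 * sqnorm R x / sqnorm R x ^+ 2)).
  by rewrite ler_pM2r ?invr_gt0 ?exprn_gt0 //; lra.
rewrite expr2 -mulf_div divff ?gt_eqF // mulr1.
by rewrite ler_pM2l // lef_pV2.
Qed.

(** The list stands for the sites visited in [L^2] steps.  At most [L^2] of them
    lie outside the box, where [gap] is [O(L^-2)]. *)
Lemma sum_gap L (vs : seq vertex) : (0 < L)%N -> uniq vs -> (size vs <= L ^ 2)%N ->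
  \sum_(x <- vs) `|gap x| <= 4 * ln L%:R + 2513.
Proof.
move=> L0 uvs svs.
have LR : 0 < L%:R ^+ 2 :> R by rewrite exprn_gt0 ?ltr0n.
rewrite (bigID (mem (box L))) /=.
have h1 : \sum_(x <- vs | x \in box L) `|gap x| <= 4 * ln L%:R + 2412.
  apply: le_trans (box_sum R L0).
  rewrite -big_filter.
  apply: (@le_trans _ _ (\sum_(x <- [seq x <- vs | x \in box L]) cell R `|x.1| `|x.2|)).
    by apply: ler_sum => x _; apply: gap_le_cell.
  have pe : perm_eq [seq x <- vs | x \in box L] [seq x <- box L | x \in vs].
    apply: uniq_perm; rewrite ?filter_uniq ?uniq_box // => x.
    by rewrite !mem_filter andbC.
  rewrite (perm_big _ pe) /= big_filter [leRHS](bigID (mem vs)) /= lerDl.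
  by apply: sumr_ge0 => x _; apply: cell_ge0.
have h2 : \sum_(x <- vs | x \notin box L) `|gap x| <= 101.
  apply: (@le_trans _ _ (\sum_(x <- vs | x \notin box L) 101 / L%:R ^+ 2)).
    by apply: ler_sum => x; apply: gap_far.
  rewrite big_const_seq iter_addr_0 -[leLHS]mulr_natl.
  apply: (@le_trans _ _ (L%:R ^+ 2 * (101 / L%:R ^+ 2))).
    rewrite ler_wpM2r ?divr_ge0 ?sqr_ge0 // -natrX ler_nat.
    exact: leq_trans (count_size _ _) svs.
  by rewrite mulrCA divff ?gt_eqF // mulr1.
lra.
Qed.

End Gap.

(** * Expectations over finite sequences of coins *)

Section Expectation.
Variables (R : realType) (q : R).

Definition coins := (bool * bool)%type.

Definition mean (F : coins -> R) : R :=
  q * ((F (true, true) + F (true, false)) / 2) +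
  (1 - q) * ((F (false, true) + F (false, false)) / 2).

(** Coin sequences are listed with the most recent coin first. *)
Fixpoint expect (k : nat) (F : seq coins -> R) : R :=
  if k is k'.+1 then expect k' (fun h => mean (fun c => F (c :: h))) else F [::].

Lemma meanD F G : mean (fun c => F c + G c) = mean F + mean G.
Proof. by rewrite /mean; ring. Qed.

Lemma meanZ a F : mean (fun c => a * F c) = a * mean F.
Proof. by rewrite /mean; ring. Qed.

Lemma mean_cst a : mean (fun=> a) = a.
Proof. by rewrite /mean; field. Qed.

Lemma expectD k F G : expect k (fun h => F h + G h) = expect k F + expect k G.
Proof.
elim: k F G => [//|k IH] F G /=; rewrite -IH; congr expect.
by apply/funext => h; rewrite meanD.
Qed.

Lemma expectZ k a F : expect k (fun h => a * F h) = a * expect k F.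
Proof.
elim: k F => [//|k IH] F /=; rewrite -IH; congr expect.
by apply/funext => h; rewrite meanZ.
Qed.

Lemma expect_cst k a : expect k (fun=> a) = a.
Proof.
elim: k => [//|k IH] /=; rewrite -[RHS]IH; congr expect.
by apply/funext => h; rewrite mean_cst.
Qed.

Lemma expect_cat k m F :
  expect (k + m) F = expect m (fun h0 => expect k (fun h => F (h ++ h0))).
Proof. by elim: k F => [//|k IH] F; rewrite addSn /= IH. Qed.

Hypothesis hq : 0 <= q <= 1.

Lemma le_mean F G : (forall c, F c <= G c) -> mean F <= mean G.
Proof.
move=> FG; case/andP: hq => q0 q1.
have := FG (true, true); have := FG (true, false).
have := FG (false, true); have := FG (false, false).
move=> h1 h2 h3 h4; rewrite /mean lerD // ler_wpM2l //; lra.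
Qed.

Lemma le_expect k F G : (forall h, size h = k -> F h <= G h) ->
  expect k F <= expect k G.
Proof.
elim: k F G => [|k IH] F G FG /=; first exact: FG.
by apply: IH => h sh; apply: le_mean => c; apply: FG; rewrite /= sh.
Qed.

Lemma eq_expect k F G : (forall h, size h = k -> F h = G h) ->
  expect k F = expect k G.
Proof. by move=> e; apply/le_anti/andP; split; apply: le_expect => h /e ->. Qed.

End Expectation.

(** * A biconvex function that detects the vicinity of the origin *)

Section Spread.
Variable R : realType.

(** A sum of the functions [|u - j|], each of which has a second difference
    exactly at [u = j]: it is convex along both axes, and strictly so in the
    box. *)
Definition spread r (x : vertex) : R :=
  \sum_(j <- irange r) ((absz (x.1 - j)%R)%:R + (absz (x.2 - j)%R)%:R).

Definition inbox r (x : vertex) : R := (x \in box r)%:R.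

Lemma sdiff_absz (u j : int) :
  ((absz (u + 1 - j)%R)%:R + (absz (u - 1 - j)%R)%:R) / 2 - (absz (u - j)%R)%:R = (u == j)%:R :> R.
Proof.
have -> : (absz (u - j)%R)%:R = ((absz (u - j)%R)%:R * 2) / 2 :> R by field.
rewrite -mulrBl -natrM -natrD.
have [->|uj] := eqVneq u j.
  have -> : (absz (j + 1 - j)%R + absz (j - 1 - j)%R = 2)%N by lia.
  have -> : (absz (j - j)%R * 2 = 0)%N by lia.
  by rewrite subr0 divff.
have -> : (absz (u + 1 - j)%R + absz (u - 1 - j)%R = absz (u - j)%R * 2)%N by lia.
by rewrite subrr mul0r.
Qed.

Lemma sum_pred1 r (u : int) : \sum_(j <- irange r) (u == j)%:R = (u \in irange r)%:R :> R.
Proof.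
rewrite -natr_sum; congr (_%:R); rewrite -count_uniq_mem ?uniq_irange //.
by rewrite -sum1_count [RHS]big_mkcond; apply: eq_bigr => j _; rewrite /= eq_sym.
Qed.

(** This holds for both labels, so the drift of [spread] cannot be avoided by
    any choice of the labels. *)
Lemma inbox_le_sdiff r l (x : vertex) : inbox r x <= sdiff (spread r) l x.
Proof.
have e (u w : int) : \sum_(j <- irange r) ((absz (u + 1 - j)%R)%:R + (absz (w - j)%R)%:R : R) / 2 +
   \sum_(j <- irange r) ((absz (u - 1 - j)%R)%:R + (absz (w - j)%R)%:R) / 2 -
   \sum_(j <- irange r) ((absz (u - j)%R)%:R + (absz (w - j)%R)%:R) = (u \in irange r)%:R.
  rewrite -sum_pred1 -big_split -sumrB /=; apply: eq_bigr => j _.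
  by rewrite -sdiff_absz; field.
rewrite /inbox /sdiff /spread mulrDl !mulr_suml.
have [h1 h2] : (x \in box r)%:R <= (x.1 \in irange r)%:R :> R /\
               (x \in box r)%:R <= (x.2 \in irange r)%:R :> R.
  by rewrite mem_box -!mem_irange !ler_nat; split; case: (_ \in _); case: (_ \in _).
case: l => /=; first by rewrite e.
have {}e (u w : int) : \sum_(j <- irange r) ((absz (w - j)%R)%:R + (absz (u + 1 - j)%R)%:R : R) / 2 +
   \sum_(j <- irange r) ((absz (w - j)%R)%:R + (absz (u - 1 - j)%R)%:R) / 2 -
   \sum_(j <- irange r) ((absz (w - j)%R)%:R + (absz (u - j)%R)%:R) = (u \in irange r)%:R.
  by rewrite -(e u w); congr (_ + _ - _); apply: eq_bigr => j _; rewrite addrC.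
by rewrite e.
Qed.

Lemma spread_ge0 r (x : vertex) : 0 <= spread r x.
Proof. by apply: sumr_ge0 => j _; rewrite addr_ge0. Qed.

Lemma size_irange r : size (irange r) = r.*2.+1.
Proof. by elim: r => //= r ->. Qed.

Lemma spread_le r L (x : vertex) : (0 < L)%N ->
  spread r x <= r.*2.+1%:R * (sqnorm R x / (2 * L%:R) + L%:R + 2 * r%:R).
Proof.
move=> L0; have LR : 0 < L%:R :> R by rewrite ltr0n.
have amgm (u : int) : `|u|%N%:R <= u%:~R ^+ 2 / (2 * L%:R) + L%:R / 2 :> R.
  rewrite -sqr_absz; move: (_%:R : R) (`|u|%N%:R) LR => M U M0.
  have -> : U ^+ 2 / (2 * M) + M / 2 = U + (U - M) ^+ 2 / (2 * M).
    by field; rewrite gt_eqF.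
  by rewrite lerDl divr_ge0 ?sqr_ge0 //; lra.
apply: (@le_trans _ _ (\sum_(j <- irange r) (sqnorm R x / (2 * L%:R) + L%:R + 2 * r%:R))).
  rewrite /spread big_seq [leRHS]big_seq; apply: ler_sum => j; rewrite mem_irange => jr.
  have tri (u : int) : (absz (u - j)%R)%:R <= `|u|%N%:R + r%:R :> R.
    by rewrite -natrD ler_nat; lia.
  rewrite /sqnorm mulrDl; have := amgm x.1; have := amgm x.2.
  have := tri x.1; have := tri x.2; lra.
by rewrite big_const_seq count_predT size_irange iter_addr_0 -[leLHS]mulr_natl.
Qed.

End Spread.

(** * The walk as a function of the past coins *)

Section Walk.
Variables (R : realType) (q : R) (n : nat) (rho : vertex -> label) (v : vertex).
Hypothesis n0 : (0 < n)%N.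
Implicit Types (s : state) (g : vertex -> R) (l : label).

Lemma neighbor_translate l b (x y : vertex) : neighbor l b x - y = neighbor l b (x - y).
Proof. by case: l; case: x y => a b' [c d]; congr pair; rewrite /= addrAC. Qed.

Lemma sdiff_translate g l x : sdiff (fun y => g (y - v)) l x = sdiff g l (x - v).
Proof. by rewrite /sdiff !neighbor_translate. Qed.

Definition mover_index (t : nat) : 'I_n := Ordinal (ltn_pmod t n0).

(** Walkers are indexed from [0] here; the walker with index [i] has the number
    [i + 1]. *)
Definition walker s (i : 'I_n) : vertex := position s i.+1.
#[local] Arguments walker : simpl never.

Definition new_label b s (x : vertex) : label :=
  if b then toggle (labels s x) else labels s x.

Lemma walker_step t b c s i :
  walker (step n t.+1 b c s) i =
  let x := walker s (mover_index t) in
  if i == mover_index t then neighbor (new_label b s x) c x else walker s i.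
Proof. by rewrite /walker /step /= eqSS. Qed.

Lemma sum_walker_step t b c s g :
  let x := walker s (mover_index t) in
  \sum_i g (walker (step n t.+1 b c s) i) =
  \sum_i g (walker s i) + (g (neighbor (new_label b s x) c x) - g x).
Proof.
move=> x; have ws i : walker (step n t.+1 b c s) i =
    if i == mover_index t then neighbor (new_label b s x) c x else walker s i.
  exact: walker_step.
move: (step n t.+1 b c s) ws => s' ws.
rewrite (bigD1 (mover_index t)) //= [in RHS](bigD1 (mover_index t)) //= ws eqxx.
rewrite (eq_bigr (fun i => g (walker s i))); last first.
  by move=> i /negbTE ni; rewrite ws ni.
by rewrite -/x; ring.
Qed.

Lemma mean_sum_walker t s g :
  let x := walker s (mover_index t) in
  mean q (fun c => \sum_i g (walker (step n t.+1 c.1 c.2 s) i)) =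
  \sum_i g (walker s i) +
  (q * sdiff g (toggle (labels s x)) x + (1 - q) * sdiff g (labels s x) x).
Proof.
move=> x; rewrite /mean !sum_walker_step /= -/x /new_label /sdiff.
by field.
Qed.

Lemma sdiff_sqnorm l x : sdiff (@sqnorm R) l x = 1.
Proof. by rewrite /sdiff !sqnorm_neighbor (@sqnorm_coord R l); field. Qed.

Fixpoint run (h : seq coins) : state :=
  if h is c :: h' then step n (size h) c.1 c.2 (run h') else initial_state rho.

(** Whatever the label, a step increases the mean squared norm of the mover by
    exactly [1]. *)
Lemma expect_sqnorm k h0 :
  expect q k (fun h => \sum_i sqnorm R (walker (run (h ++ h0)) i - v)) =
  \sum_i sqnorm R (walker (run h0) i - v) + k%:R.
Proof.
elim: k => [|k IH] /=; first by rewrite addr0.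
rewrite -natr1 addrA -IH -[1 in RHS](expect_cst q k 1) -expectD; congr expect.
apply/funext => h; rewrite (mean_sum_walker _ _ (fun y => sqnorm R (y - v))).
by rewrite !sdiff_translate !sdiff_sqnorm; congr (_ + _); ring.
Qed.

(** The number of steps since the last move of the walker, taken modulo [n] so
    that it also makes sense before the first move. *)
Definition age (t : nat) (i : 'I_n) : nat := ((t + n - i.+1) %% n)%N.

Lemma ageS t i : age t.+1 i = if i == mover_index t then 0%N else (age t i).+1.
Proof.
rewrite -val_eqE /= /age; have i_n := ltn_ord i.
have e : (t.+1 + n - i.+1 = (t + n - i.+1).+1)%N by lia.
rewrite e modnS; congr (if _ then _ else _).
rewrite -e; have -> : (t.+1 + n - i.+1 = t + n - i)%N by lia.
rewrite -eqn_mod_dvd; last by lia.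
by rewrite modnDr (modn_small i_n) eq_sym.
Qed.

Lemma age_mover t : age t (mover_index t) = n.-1.
Proof.
have := ageS t (mover_index t); rewrite eqxx /age.
have i_n := ltn_ord (mover_index t).
have -> : (t.+1 + n - (mover_index t).+1 = (t + n - (mover_index t).+1).+1)%N by lia.
rewrite modnS; case: ifP => // /dvdnP[k ek] _.
have -> : (t + n - (mover_index t).+1 = k.-1 * n + n.-1)%N.
  by case: k ek => [|k]; lia.
by rewrite modnMDl modn_small // ltn_predL.
Qed.

Lemma age_le t i : (age t i <= n)%N.
Proof. by rewrite ltnW // ltn_pmod. Qed.

Definition crowd r s : R := \sum_i inbox R r (walker s i - v).

(** Each walker moves once in [n] steps, but [crowd] counts it at every step.
    The credit [age] anticipates the drift of [n] times [spread], which arises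
    only at the move, and distributes it over the [n] steps that end there. *)
Definition clock r t s : R :=
  \sum_i (age t i)%:R * inbox R r (walker s i - v) +
  n%:R * \sum_i spread R r (walker s i - v).

Hypothesis hq : 0 <= q <= 1.

(** A walker that waits gains one unit of [age] when it is in the box.  The
    mover loses its credit [n - 1], and the drift of [n] times [spread] returns
    [n]. *)
Lemma mean_clock r t s :
  clock r t s + crowd r s <= mean q (fun c => clock r t.+1 (step n t.+1 c.1 c.2 s)).
Proof.
pose x := walker s (mover_index t).
have e c : \sum_i (age t.+1 i)%:R * inbox R r (walker (step n t.+1 c.1 c.2 s) i - v) =
  \sum_i (age t i)%:R * inbox R r (walker s i - v) + crowd r s - n%:R * inbox R r (x - v).
  have -> : n%:R * inbox R r (x - v) =
      \sum_i (if i == mover_index t then n%:R * inbox R r (walker s i - v) else 0).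
    by rewrite -big_mkcond big_pred1_eq.
  rewrite -big_split -sumrB /=; apply: eq_bigr => i _.
  rewrite walker_step ageS; case: eqVneq => [->|_].
    have en : n%:R = n.-1%:R + 1 :> R by rewrite natr1 prednK.
    by rewrite mul0r age_mover en; ring.
  by rewrite -natr1; ring.
rewrite /clock; under [X in mean _ X]eq_fun do rewrite e.
rewrite meanD mean_cst meanZ (mean_sum_walker _ _ (fun y => spread R r (y - v))) -/x.
rewrite !sdiff_translate -/x mulrDr.
have h1 := inbox_le_sdiff R r (toggle (labels s x)) (x - v).
have h2 := inbox_le_sdiff R r (labels s x) (x - v).
case/andP: hq => q0 q1.
have : n%:R * inbox R r (x - v) <= n%:R * (q * sdiff (spread R r) (toggle (labels s x)) (x - v) +
         (1 - q) * sdiff (spread R r) (labels s x) (x - v)).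
  rewrite ler_wpM2l //.
  have p0 : 0 <= 1 - q by rewrite subr_ge0.
  have := ler_wpM2l q0 h1; have := ler_wpM2l p0 h2; lra.
lra.
Qed.

End Walk.

(** * The energy supermartingale *)

Section Block.
Variables (R : realType) (q : R) (n : nat) (rho : vertex -> label) (v : vertex).
Hypothesis n0 : (0 < n)%N.
Hypothesis hq : 0 < q <= 1.
Implicit Types (h : seq coins) (x : vertex) (l : label).

Local Notation run := (run n rho).

Let hq01 : 0 <= q <= 1. Proof. by case/andP: hq => /ltW -> ->. Qed.

Let q0 : 0 < q. Proof. by case/andP: hq. Qed.

Definition next_site h : vertex := position (run h) (mover n (size h).+1).

Lemma run_cons c h : run (c :: h) = step n (size h).+1 c.1 c.2 (run h).
Proof. by []. Qed.

(** The coins of [h] follow those of [h0]. *)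
Fixpoint quiet h h0 : bool :=
  if h is _ :: h' then quiet h' h0 && (next_site (h' ++ h0) != v) else true.

Fixpoint departures h h0 : seq vertex :=
  if h is _ :: h' then next_site (h' ++ h0) :: departures h' h0 else [::].

Lemma size_departures h h0 : size (departures h h0) = size h.
Proof. by elim: h => //= c h ->. Qed.

Lemma labels_run_cons c h x :
  labels (run (c :: h)) x =
  if x == next_site h then new_label c.1 (run h) x else labels (run h) x.
Proof. by rewrite run_cons /step /=; case: eqVneq => // ->. Qed.

Lemma labels_undeparted h h0 x : x \notin departures h h0 ->
  labels (run (h ++ h0)) x = labels (run h0) x.
Proof.
elim: h => // c h IH; rewrite cat_cons labels_run_cons [departures _ _]/= inE negb_or.
by move=> /andP[/negbTE -> /IH].
Qed.

(** The difference of the two weights cancels the mean bias of the walk: a step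
    from a vertex with label H has the mean increment [(1 - 2 q) g] in terms of
    the horizontal second difference [g], up to a nonpositive term, and it
    turns H into V with probability [q]. *)
Definition weight x l : R := if l is LabelV then (2 * q - 1) / q * gap R x else 0.

Definition label_change h h0 x : R :=
  weight (x - v) (labels (run (h ++ h0)) x) - weight (x - v) (labels (run h0) x).

Definition correction h h0 : R :=
  \sum_(x <- undup (departures h h0)) label_change h h0 x.

Lemma correction_cons c h h0 :
  let x := next_site (h ++ h0) in
  correction (c :: h) h0 = correction h h0 +
    (weight (x - v) (new_label c.1 (run (h ++ h0)) x)
     - weight (x - v) (labels (run (h ++ h0)) x)).
Proof.
move=> x; pose rest := \sum_(y <- undup (departures h h0) | y != x) label_change h h0 y.
have e1 : correction h h0 = label_change h h0 x + rest.
  rewrite /correction /rest; have [xV|xV] := boolP (x \in departures h h0).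
    by rewrite (bigD1_seq x) ?mem_undup ?undup_uniq.
  rewrite /label_change (labels_undeparted xV) subrr add0r.
  rewrite big_seq [RHS]big_seq_cond; apply: eq_bigl => y.
  by case: eqVneq xV => [->|_ _]; rewrite ?andbT ?andbF // mem_undup => /negbTE.
have e2 : correction (c :: h) h0 = label_change (c :: h) h0 x + rest.
  rewrite /correction /= -/x.
  have er : rest = \sum_(y <- undup (departures h h0) | y != x) label_change (c :: h) h0 y.
    apply: eq_bigr => y /negbTE yx.
    by rewrite /label_change cat_cons labels_run_cons -/x yx.
  rewrite er; case: ifPn => xV.
    by rewrite (bigD1_seq x) ?mem_undup ?undup_uniq.
  rewrite big_cons; congr (_ + _); rewrite big_seq [RHS]big_seq_cond; apply: eq_bigl => y.
  by case: eqVneq xV => [->|_ _]; rewrite ?andbT ?andbF // mem_undup => /negbTE.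
rewrite e1 e2 /label_change cat_cons labels_run_cons -/x eqxx; ring.
Qed.

Definition energy h h0 : R :=
  \sum_(i < n) potential R (walker (run (h ++ h0)) i - v) + correction h h0.

(** After the weights have been put in, the left side is [q] or [1 - q] times
    the sum of the two second differences. *)
Lemma drift_le0 l x : x != 0 ->
  q * sdiff (@potential R) (toggle l) x + (1 - q) * sdiff (@potential R) l x +
  q * (weight x (toggle l) - weight x l) <= 0.
Proof.
move=> x0; have := superharmonic R x0; rewrite /weight /gap (negbTE x0).
case/andP: hq01 => q00 q1.
set A := sdiff _ LabelH x; set B := sdiff _ LabelV x => AB.
have -> : (2 * q - 1) / q * A = (2 * A - A / q) by field; rewrite gt_eqF.
have e : q * (A / q) = A by rewrite mulrCA divff ?gt_eqF // mulr1.
by case: l => /=; rewrite -/A -/B; nra.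
Qed.

Lemma mean_energy h h0 : next_site (h ++ h0) != v ->
  mean q (fun c => energy (c :: h) h0) <= energy h h0.
Proof.
move=> nv; rewrite /energy meanD.
rewrite (mean_sum_walker q n0 _ _ (fun y => potential R (y - v))) !sdiff_translate.
set x := walker _ _; have ex : x = next_site (h ++ h0) by [].
set l := labels _ x.
have -> : mean q (fun c => correction (c :: h) h0) =
    correction h h0 + q * (weight (x - v) (toggle l) - weight (x - v) l).
  by rewrite /mean !correction_cons /= -ex -/l; field.
have := @drift_le0 l (x - v); rewrite subr_eq0 ex nv => /(_ isT).
lra.
Qed.

(** The energy, frozen just before the first departure from [v]. *)
Fixpoint stopped h h0 : R :=
  if h is _ :: h' then if quiet h h0 then energy h h0 else stopped h' h0
  else energy h h0.

Lemma stopped_quiet h h0 : quiet h h0 -> stopped h h0 = energy h h0.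
Proof. by case: h => // c h /= ->. Qed.

Lemma mean_stopped h h0 : mean q (fun c => stopped (c :: h) h0) <= stopped h h0.
Proof.
rewrite /=; have [/andP[qh nv]|_] := boolP (_ && _); last by rewrite mean_cst.
by rewrite (stopped_quiet qh); apply: mean_energy.
Qed.

Lemma expect_stopped k h0 : expect q k (stopped^~ h0) <= energy [::] h0.
Proof.
elim: k => //= k IH; apply: le_trans IH.
by apply: le_expect => // h _; apply: mean_stopped.
Qed.

(** Half of the critical number [|4 q - 2| / q]; see [label_factorE]. *)
Definition label_factor : R := `|2 * q - 1| / q.

Lemma label_factor_ge0 : 0 <= label_factor.
Proof. by rewrite divr_ge0 // ltW. Qed.

Lemma correction_ge L h h0 : (0 < L)%N -> (size h <= L ^ 2)%N ->
  - (label_factor * (4 * ln L%:R + 2513)) <= correction h h0.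
Proof.
move=> L0 hL.
have wle x l l' : - (label_factor * `|gap R x|) <= weight x l - weight x l'.
  have ge0 : 0 <= label_factor * `|gap R x| by rewrite mulr_ge0 ?label_factor_ge0.
  have : `|(2 * q - 1) / q * gap R x| = label_factor * `|gap R x|.
    by rewrite !normrM /label_factor normfV (gtr0_norm q0).
  move/eqP; rewrite eqr_norml => /andP[/orP[] /eqP e _]; case: l; case: l'; rewrite /weight ?e; lra.
have vs : \sum_(x <- undup (departures h h0)) `|gap R (x - v)| <= 4 * ln L%:R + 2513.
  rewrite -(big_map (fun x => x - v) xpredT (fun y => `|gap R y|)).
  apply: sum_gap => //; first by rewrite map_inj_uniq ?undup_uniq //; apply: addIr.
  by rewrite size_map (leq_trans (size_undup _)) // size_departures.
apply: le_trans (_ : - (label_factor * \sum_(x <- undup (departures h h0)) `|gap R (x - v)|) <= _).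
  by rewrite lerN2 ler_wpM2l ?label_factor_ge0.
by rewrite mulr_sumr -sumrN; apply: ler_sum => x _; apply: wle.
Qed.

(** The constant [20] makes the right side nonnegative inside the box. *)
Lemma potential_far r x : (0 < r)%N ->
  ln (r%:R ^+ 2) * (1 - inbox R r x) <= potential R x + 20.
Proof.
move=> r0; have p20 := potential_ge R x.
rewrite /inbox; case: (boolP (x \in box r)) => [_|xr]; first by rewrite subrr mulr0; lra.
have rR : 0 < r%:R ^+ 2 :> R by rewrite exprn_gt0 ?ltr0n.
have sr : r%:R ^+ 2 <= sqnorm R x := sqnorm_outside_box R xr.
have s0 : 0 < sqnorm R x := lt_le_trans rR sr.
have s1 := sqnorm_ge1 R (sqnorm_neq0 s0).
rewrite subr0 mulr1 potential_radial ?(sqnorm_neq0 s0) // /radial.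
have : ln (r%:R ^+ 2) <= ln (sqnorm R x) by rewrite ler_ln ?posrE.
have : 2 / sqnorm R x <= 2 by rewrite ler_pdivrMr //; lra.
lra.
Qed.

(** On the event of a departure the walkers are bounded below only by the
    minimum of the potential; otherwise every walker outside the box of radius
    [r] contributes [ln (r^2)]. *)
Lemma stopped_ge L r h h0 : (0 < L)%N -> (0 < r)%N -> (size h <= L ^ 2)%N ->
  - (label_factor * (4 * ln L%:R + 2513)) - 20 * n%:R +
  ln (r%:R ^+ 2) * (n%:R * (quiet h h0)%:R - crowd R n v r (run (h ++ h0)))
  <= stopped h h0.
Proof.
move=> L0 r0.
set A := - (label_factor * _) - _.
have lr : 0 <= ln (r%:R ^+ 2 : R) by rewrite ln_ge0 // exprn_ege1 // ler1n.
have crowd_ge0 s : 0 <= crowd R n v r s :> R.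
  by apply: sumr_ge0 => i _; rewrite /inbox.
have energy_ge h' : (size h' <= L ^ 2)%N -> A +
    ln (r%:R ^+ 2) * (n%:R - crowd R n v r (run (h' ++ h0))) <= energy h' h0.
  move=> /(correction_ge h0 L0) hc; rewrite /energy /A.
  have : \sum_(i < n) ln (r%:R ^+ 2) * (1 - inbox R r (walker (run (h' ++ h0)) i - v)) <=
         \sum_(i < n) (potential R (walker (run (h' ++ h0)) i - v) + 20).
    by apply: ler_sum => i _; apply: potential_far.
  rewrite -mulr_sumr sumrB big_split /= !sumr_const !card_ord -/(crowd R n v r _).
  rewrite -[20 *+ n]mulr_natr; move: hc; lra.
have energy_ge' h' : (size h' <= L ^ 2)%N -> A <= energy h' h0.
  move=> /(correction_ge h0 L0) hc; rewrite /energy /A.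
  have : \sum_(i < n) (-20 : R) <= \sum_(i < n) potential R (walker (run (h' ++ h0)) i - v).
    by apply: ler_sum => i _; apply: potential_ge.
  rewrite sumr_const card_ord -mulr_natr; lra.
have stopped_ge' h' : (size h' <= L ^ 2)%N -> A <= stopped h' h0.
  elim: h' => [|c h' IH] hs; first exact: energy_ge'.
  by rewrite /=; case: ifP => _; [apply: energy_ge' | apply: IH (ltnW hs)].
move=> hs; have [qh|qh] := boolP (quiet h h0).
  by rewrite mulr1 stopped_quiet //; apply: energy_ge.
rewrite mulr0 sub0r; apply: le_trans (stopped_ge' _ hs).
by rewrite gerDl mulrN oppr_le0 mulr_ge0.
Qed.

End Block.

(** * The probability of never leaving the target in a block of steps *)

Section Escape.
Variables (R : realType) (q : R) (n : nat) (rho : vertex -> label) (v : vertex).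
Hypothesis n0 : (0 < n)%N.
Hypothesis hq : 0 < q <= 1.
Implicit Types (h : seq coins).

Local Notation run := (run n rho).
Local Notation quiet := (quiet n rho v).

Let hq01 : 0 <= q <= 1. Proof. by case/andP: hq => /ltW -> ->. Qed.

Definition quiet_proba k h0 : R := expect q k (fun h => (quiet h h0)%:R).

Lemma quiet_proba_mono k m h0 : (k <= m)%N -> quiet_proba m h0 <= quiet_proba k h0.
Proof.
move/subnKC <-; elim: (m - k)%N => [|d IH]; first by rewrite addn0.
apply: le_trans IH; rewrite addnS /quiet_proba /=; apply: le_expect => // h _.
rewrite -[leRHS](mean_cst q); apply: le_mean => // c /=.
by rewrite ler_nat; case: (quiet h h0) => //; case: (_ != _).
Qed.

(** The [clock] is nonnegative at the start and its mean grows by at least the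
    mean [crowd] at each step. *)
Lemma sum_crowd r m h0 :
  \sum_(k < m) expect q k (fun h => crowd R n v r (run (h ++ h0))) <=
  expect q m (fun h => clock R n v r (size (h ++ h0)) (run (h ++ h0))).
Proof.
elim: m => [|m IH].
  rewrite big_ord0 addr_ge0 ?mulr_ge0 ?sumr_ge0 // => i _.
    by rewrite mulr_ge0.
  exact: spread_ge0.
rewrite big_ord_recr /=; apply: le_trans (lerD IH (lexx _)) _.
rewrite -expectD; apply: le_expect => // h _.
exact: (mean_clock v n0 hq01 r (size (h ++ h0))).
Qed.

(** The squared distances to [v] bound both the initial energy and the initial
    value of [spread]. *)
Definition dispersion h0 : R := \sum_(i < n) sqnorm R (walker (run h0) i - v).

Lemma dispersion_ge0 h0 : 0 <= dispersion h0.
Proof. by apply: sumr_ge0 => i _; rewrite sqnorm_nat. Qed.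

(** The mean of [spread] is at most linear in the typical distance, that is in
    [L] after [L^2] steps, with a slope of order [r].  The time spent in the
    box of radius [r] is therefore of order [r L], which is negligible against
    [L^2] when [r] is small against [L]. *)
Lemma occupation r L h0 : (0 < L)%N ->
  \sum_(k < L ^ 2) expect q k (fun h => crowd R n v r (run (h ++ h0))) <=
  n%:R * n%:R + n%:R * (r.*2.+1%:R *
    ((dispersion h0 + L%:R ^+ 2) / (2 * L%:R) + n%:R * L%:R + n%:R * (2 * r%:R))).
Proof.
move=> L0; apply: le_trans (sum_crowd r _ h0) _.
rewrite -natrX -(expect_sqnorm q rho v n0).
set D := fun h => \sum_(i < n) sqnorm R (walker (run (h ++ h0)) i - v).
have -> : n%:R * n%:R + n%:R * (r.*2.+1%:R *
    (expect q (L ^ 2) D / (2 * L%:R) + n%:R * L%:R + n%:R * (2 * r%:R))) =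
  expect q (L ^ 2) (fun h => n%:R * n%:R + n%:R * (r.*2.+1%:R * (n%:R * L%:R + n%:R * (2 * r%:R)))
     + (n%:R * r.*2.+1%:R / (2 * L%:R)) * D h).
  rewrite expectD expect_cst expectZ; field.
  by rewrite pnatr_eq0 -lt0n.
apply: le_expect => // h _; rewrite /clock -/(D h).
have h1 : \sum_(i < n) (age (size (h ++ h0)) i)%:R * inbox R r (walker (run (h ++ h0)) i - v)
   <= n%:R * n%:R.
  apply: (@le_trans _ _ (\sum_(i < n) n%:R)); last by rewrite sumr_const card_ord mulr_natr.
  apply: ler_sum => i _; rewrite -[leRHS]mulr1; apply: ler_pM => //.
    by rewrite ler_nat (age_le n0).
  by rewrite /inbox lern1 leq_b1.
have h2 : \sum_(i < n) spread R r (walker (run (h ++ h0)) i - v) <=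
    r.*2.+1%:R * (D h / (2 * L%:R) + n%:R * L%:R + n%:R * (2 * r%:R)).
  apply: (@le_trans _ _ (\sum_(i < n) r.*2.+1%:R *
     (sqnorm R (walker (run (h ++ h0)) i - v) / (2 * L%:R) + L%:R + 2 * r%:R))).
    by apply: ler_sum => i _; apply: spread_le.
  rewrite -mulr_sumr !big_split /= !sumr_const card_ord -!mulr_suml.
  by rewrite -[X in _ + X + _]mulr_natl -[X in _ + _ + X]mulr_natl.
have nR : 0 <= n%:R :> R by [].
apply: le_trans (lerD h1 (ler_wpM2l nR h2)) _.
rewrite le_eqVlt; apply/orP; left; apply/eqP; field.
by rewrite pnatr_eq0 -lt0n.
Qed.

Lemma energy0_le h0 : energy q n rho v [::] h0 <= n%:R * ln (1 + dispersion h0).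
Proof.
rewrite /energy /correction /= big_nil addr0.
apply: (@le_trans _ _ (\sum_(i < n) ln (1 + dispersion h0))); last first.
  by rewrite sumr_const card_ord mulr_natl.
have D0 := dispersion_ge0 h0.
apply: ler_sum => i _; set x := _ - v.
have xD : sqnorm R x <= dispersion h0.
  rewrite /dispersion (bigD1 i) //= lerDl; apply: sumr_ge0 => j _.
  by rewrite sqnorm_nat.
have [x0|x0] := eqVneq x 0.
  rewrite /potential x0 eqxx; apply: le_trans (_ : 0 <= _); first by lra.
  by rewrite ln_ge0 // lerDl.
apply: le_trans (potential_le R x0) _; have := sqnorm_ge1 R x0 => s1.
by rewrite ler_ln ?posrE; lra.
Qed.

(** The sum over all times before [L^2] of the inequality between the initial
    and the current mean of the stopped energy; the probability of being quiet
    is smallest at the last time. *)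
Lemma quiet_proba_bound r L h0 : (0 < L)%N -> (0 < r)%N ->
  L%:R ^+ 2 * (n%:R * ln (r%:R ^+ 2) * quiet_proba (L ^ 2) h0) <=
  L%:R ^+ 2 * (n%:R * ln (1 + dispersion h0) + label_factor q * (4 * ln L%:R + 2513) + 20 * n%:R)
  + ln (r%:R ^+ 2) *
    \sum_(k < L ^ 2) expect q k (fun h => crowd R n v r (run (h ++ h0))).
Proof.
move=> L0 r0.
have lr : 0 <= ln (r%:R ^+ 2 : R) by rewrite ln_ge0 // exprn_ege1 // ler1n.
set A := n%:R * ln (1 + _) + _ + _.
have one (k : 'I_(L ^ 2)) : n%:R * ln (r%:R ^+ 2) * quiet_proba (L ^ 2) h0 <=
   A + ln (r%:R ^+ 2) * expect q k (fun h => crowd R n v r (run (h ++ h0))).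
  have kL := ltn_ord k.
  apply: (@le_trans _ _ (n%:R * ln (r%:R ^+ 2) * quiet_proba k h0)).
    by rewrite ler_wpM2l ?mulr_ge0 // quiet_proba_mono // ltnW.
  have := le_trans (expect_stopped rho v n0 hq k h0) (energy0_le h0).
  set e := expect q k (stopped q n rho v ^~ h0) => he.
  have : expect q k (fun h =>
      - (label_factor q * (4 * ln L%:R + 2513)) - 20 * n%:R +
      (n%:R * ln (r%:R ^+ 2)) * (quiet h h0)%:R +
      (- ln (r%:R ^+ 2)) * crowd R n v r (run (h ++ h0))) <= e.
    apply: le_expect => // h hk.
    have := @stopped_ge R q n rho v hq L r h h0 L0 r0.
    rewrite hk => /(_ (ltnW kL)); lra.
  rewrite !expectD !expect_cst !expectZ -/(quiet_proba k h0) /A; lra.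
rewrite mulr_sumr -natrX.
have -> (x : R) : (L ^ 2)%N%:R * x = \sum_(k < L ^ 2) x.
  by rewrite sumr_const card_ord mulr_natl.
have -> (x : R) : (L ^ 2)%N%:R * x = \sum_(k < L ^ 2) x.
  by rewrite sumr_const card_ord mulr_natl.
by rewrite -big_split /=; apply: ler_sum => k _; apply: one.
Qed.

Hypothesis hn : `|4 * q - 2| / q < n%:R.

Lemma label_factorE : 2 * label_factor q = `|4 * q - 2| / q.
Proof.
have -> : 4 * q - 2 = 2 * (2 * q - 1) by ring.
by rewrite normrM gtr0_norm // /label_factor mulrA.
Qed.

(** Take [L = K r].  The constant [K] is chosen first, so large that the walkers
    spend a small proportion of the time in the box of radius [r]; since it is
    fixed, the difference between [ln (r^2)] and [ln (L^2)] stays bounded.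
    Then [r] is chosen so large that [ln (r^2)] dominates all constants,
    including the initial energy. *)
Lemma quiet_block : exists2 eps : R, 0 < eps <= 1 & forall B : nat, exists T : nat,
  forall h0, dispersion h0 <= B%:R -> quiet_proba T h0 <= 1 - eps.
Proof.
set c := 2 * label_factor q; have cn : c < n%:R by rewrite /c label_factorE.
have c0 : 0 <= c by rewrite mulr_ge0 // label_factor_ge0.
have nR : 0 < n%:R :> R by rewrite ltr0n.
pose delta := n%:R - c; have d0 : 0 < delta by rewrite subr_gt0.
exists (delta / (2 * n%:R)).
  rewrite divr_gt0 ?mulr_gt0 //= ler_pdivrMr ?mulr_gt0 // /delta; lra.
move=> B.
(* 13 collects the constants 1 and 12 of the occupation bound below. *)
pose K := (Num.Def.archi_bound (13 * n%:R ^+ 2 / (delta / 4))).+1.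
have K0 : 0 < K%:R :> R by rewrite ltr0n.
have hK : 13 * n%:R ^+ 2 <= delta / 4 * K%:R.
  rewrite [leRHS]mulrC -ler_pdivrMr ?divr_gt0 //.
  have x0 : 0 <= 13 * n%:R ^+ 2 / (delta / 4).
    apply: divr_ge0; first by rewrite mulr_ge0 ?sqr_ge0.
    by rewrite divr_ge0 // ltW.
  apply: le_trans (ltW (archi_boundP x0)) _.
  by rewrite ler_nat.
pose A : R := n%:R * ln (1 + B%:R) + label_factor q * (4 * ln K%:R + 2513) + 20 * n%:R.
pose y := expR (A / (delta / 4)) + B%:R.
pose r := (Num.Def.archi_bound y).+1.
have y0 : 0 <= y by rewrite addr_ge0 // expR_ge0.
have yr : y <= r%:R.
  by apply: le_trans (ltW (archi_boundP y0)) _; rewrite ler_nat.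
have r2 : (1 < r)%N.
  by rewrite /r ltnS -(ltr0n R); apply: le_lt_trans y0 (archi_boundP y0).
clearbody r K.
have r0 : (0 < r)%N by apply: ltnW.
have rR : 0 < r%:R :> R by rewrite ltr0n.
have r1 : 1 <= r%:R :> R by rewrite ler1n.
have K1 : 1 <= K%:R :> R by rewrite ler1n -(ltr0n R).
have lnr : A <= delta / 4 * ln (r%:R ^+ 2).
  rewrite [leRHS]mulrC -ler_pdivrMr ?divr_gt0 // lnXn // mulr2n.
  have : A / (delta / 4) <= ln r%:R.
    rewrite -ler_expR lnK ?posrE //; apply: le_trans yr.
    by rewrite lerDl.
  have : 0 <= ln (r%:R : R) by rewrite ln_ge0.
  move: (A / _) => z; lra.
have Br : B%:R <= r%:R :> R.
  by apply: le_trans yr; rewrite lerDr expR_ge0.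
pose L := (K * r)%N.
have L0 : (0 < L)%N by rewrite muln_gt0 r0 andbT -(ltr0n R).
have eL : L%:R = K%:R * r%:R :> R by rewrite natrM.
exists (L ^ 2)%N => h0 hB; clearbody L.
have LR : 0 < L%:R :> R by rewrite ltr0n.
have rL : r%:R <= L%:R :> R by rewrite eL ler_peMl // ltW.
have L1 : 1 <= L%:R :> R by rewrite ler1n.
have lr : 0 <= ln (r%:R ^+ 2 : R) by rewrite ln_ge0 // exprn_ege1.
have n1 : 1 <= n%:R :> R by rewrite ler1n.
have occ : \sum_(k < L ^ 2) expect q k (fun h => crowd R n v r (run (h ++ h0))) <=
    L%:R ^+ 2 * (delta / 4).
  apply: le_trans (occupation r h0 L0) _.
  have r3 : r.*2.+1%:R <= 3 * r%:R :> R.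
    by rewrite -natrM ler_nat mulSn mul2n -add1n leq_add2r.
  have D1 : (dispersion h0 + L%:R ^+ 2) / (2 * L%:R) <= L%:R.
    rewrite ler_pdivrMr ?mulr_gt0 //.
    have : dispersion h0 <= L%:R ^+ 2.
      apply: le_trans hB (le_trans Br _); apply: le_trans rL _.
      by rewrite expr2 ler_peMl // ltW.
    lra.
  have D2 : (dispersion h0 + L%:R ^+ 2) / (2 * L%:R) + n%:R * L%:R + n%:R * (2 * r%:R)
      <= 4 * (n%:R * L%:R).
    have : n%:R * r%:R <= n%:R * L%:R :> R by rewrite ler_pM2l.
    have : L%:R <= n%:R * L%:R :> R by rewrite ler_peMl // ltW.
    lra.
  have D3 : r.*2.+1%:R * ((dispersion h0 + L%:R ^+ 2) / (2 * L%:R) + n%:R * L%:R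
      + n%:R * (2 * r%:R)) <= 3 * r%:R * (4 * (n%:R * L%:R)).
    apply: ler_pM => //; rewrite !addr_ge0 ?mulr_ge0 ?invr_ge0 //.
    by rewrite addr_ge0 ?sqr_ge0 ?dispersion_ge0.
  have {D3} := ler_wpM2l (ltW nR) D3 => D3.
  have eK : r%:R * L%:R * K%:R = L%:R ^+ 2 :> R by rewrite eL; ring.
  have D4 : n%:R * n%:R <= n%:R ^+ 2 * (r%:R * L%:R) :> R.
    by rewrite -expr2 ler_peMr ?sqr_ge0 // mulr_ege1.
  have rL0 : 0 <= r%:R * L%:R :> R by rewrite mulr_ge0.
  have := ler_wpM2r rL0 hK => h13.
  apply: le_trans (lerD D4 D3) _; rewrite -eK.
  move: h13; move: (n%:R) (r%:R) (L%:R) (K%:R) (delta) => N r' L' K' e h; lra.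
have main := quiet_proba_bound h0 L0 r0.
have L20 : 0 < L%:R ^+ 2 :> R by rewrite exprn_gt0.
have {}occ := ler_wpM2l lr occ.
have {main occ} : n%:R * ln (r%:R ^+ 2) * quiet_proba (L ^ 2) h0 <=
   n%:R * ln (1 + dispersion h0) + label_factor q * (4 * ln L%:R + 2513) + 20 * n%:R
   + ln (r%:R ^+ 2) * (delta / 4).
  rewrite -(ler_pM2l L20); lra.
have lD : n%:R * ln (1 + dispersion h0) <= n%:R * ln (1 + B%:R).
  have D0 := dispersion_ge0 h0; have B0 := le_trans D0 hB.
  apply: ler_wpM2l; first exact: ltW.
  by rewrite ler_ln ?posrE ?ltr_pwDl ?lerD2l.
have eln : ln L%:R = ln K%:R + ln r%:R :> R by rewrite eL lnM ?posrE.
have e2 : ln (r%:R ^+ 2) = 2 * ln r%:R :> R by rewrite lnXn // mulr2n; lra.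
have lnr0 : 0 < ln (r%:R ^+ 2 : R).
  by rewrite ln_gt0 // exprn_egt1 // ltr1n.
move=> main.
have {main} : ln (r%:R ^+ 2) * (n%:R * quiet_proba (L ^ 2) h0) <=
   ln (r%:R ^+ 2) * (n%:R - delta / 2).
  move: main lnr; rewrite /A eln; rewrite /delta /c in lD *.
  have : label_factor q * (4 * (ln K%:R + ln r%:R) + 2513) =
         label_factor q * (4 * ln K%:R + 2513) + 2 * label_factor q * ln (r%:R ^+ 2).
    by rewrite e2; ring.
  lra.
rewrite ler_pM2l // => main.
rewrite -(ler_pM2l nR); apply: le_trans main _.
rewrite le_eqVlt; apply/orP; left; apply/eqP; field.
by rewrite gt_eqF.
Qed.

End Escape.

(** * Consecutive blocks *)

Section Iterate.
Variables (R : realType) (q : R) (n : nat) (rho : vertex -> label) (v : vertex).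
Hypothesis n0 : (0 < n)%N.
Hypothesis hq : 0 < q <= 1.
Hypothesis hn : `|4 * q - 2| / q < n%:R.
Implicit Types (h : seq coins).

Local Notation run := (run n rho).
Local Notation quiet := (quiet n rho v).
Local Notation quiet_proba := (quiet_proba q n rho v).

Let hq01 : 0 <= q <= 1. Proof. by case/andP: hq => /ltW -> ->. Qed.

Lemma position_bound h i :
  (`|(position (run h) i).1| <= size h)%N /\ (`|(position (run h) i).2| <= size h)%N.
Proof.
elim: h i => [//|c h IH] i; rewrite run_cons /step /=.
case: eqP => _; last by have [] := IH i; split; apply: leqW.
have [] := IH (mover n (size h).+1).
move: (position _ _) => [x y] /= hx hy.
by case: (if c.1 then _ else _); case: c.2 => /=; lia.
Qed.

Lemma dispersion_le h :
  dispersion R n rho v h <= (n * (2 * (size h + `|v.1| + `|v.2|) ^ 2))%N%:R.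
Proof.
rewrite natrM -[X in X%:R * _]card_ord mulr_natl -sumr_const.
apply: ler_sum => i _; rewrite sqnorm_nat ler_nat mul2n -addnn.
have [h1 h2] := position_bound h i.+1.
rewrite /walker; move: (position _ _) h1 h2 => [x y] /= h1 h2.
by apply: leq_add; rewrite leq_exp2r //; lia.
Qed.

Lemma quiet_cat h' h h0 : quiet (h' ++ h) h0 = quiet h h0 && quiet h' (h ++ h0).
Proof.
elim: h' => [|c h' IH] /=; first by rewrite andbT.
by rewrite IH -catA andbA.
Qed.

(** A block may start from any labels, so the bound on one block applies again
    after each block, with a length adapted to the distances that the walkers
    can have reached. *)
Lemma quiet_iter : exists2 y : R, 0 <= y < 1 & forall m D : nat, exists k : nat,
  forall h0, size h0 = D -> quiet_proba k h0 <= y ^+ m.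
Proof.
have [eps /andP[e0 e1] block] := quiet_block rho v n0 hq hn.
exists (1 - eps); first by apply/andP; split; lra.
elim=> [|m IH] D.
  by exists 0%N => h0 _; rewrite expr0 /quiet_proba /=.
have [T hT] := block (n * (2 * (D + `|v.1| + `|v.2|) ^ 2))%N.
have [k hk] := IH (T + D)%N.
exists (k + T)%N => h0 sh0; rewrite /quiet_proba expect_cat exprS mulrC.
apply: (@le_trans _ _ (expect q T (fun h => (1 - eps) ^+ m * (quiet h h0)%:R))).
  apply: le_expect => // h sh.
  rewrite (eq_expect hq01 (G := fun h' => (quiet h h0)%:R * (quiet h' (h ++ h0))%:R)); last first.
    by move=> h' _; rewrite quiet_cat -natrM mulnb.
  rewrite expectZ mulrC ler_wpM2r //; apply: hk.
  by rewrite size_cat sh sh0.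
rewrite expectZ ler_wpM2l ?exprn_ge0 //; first by lra.
by apply: hT; rewrite -sh0; apply: dispersion_le.
Qed.

End Iterate.

(** * Coin sequences in the probability space *)

Section Histories.
Context {d : measure_display} {T : measurableType d} {R : realType}.
Variables (P : probability T R) (q : R) (flip plus : nat -> T -> bool).
Hypothesis choices : hv_choices P q flip plus.

Definition coin_at (t : nat) (w : T) : coins := (flip t w, plus t w).

Fixpoint hist (w : T) (t : nat) : seq coins :=
  if t is t'.+1 then coin_at t w :: hist w t' else [::].

Lemma size_hist w t : size (hist w t) = t.
Proof. by elim: t => //= t ->. Qed.

Lemma run_hist n rho w t : run n rho (hist w t) = hv_walk n rho (flip^~ w) (plus^~ w) t.
Proof. by elim: t => //= t <-; rewrite size_hist. Qed.

Lemma measurable_bool (f : T -> bool) : measurable_fun setT f -> measurable [set w | f w].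
Proof.
move=> mf; have := mf measurableT [set true] I; rewrite setTI.
by congr measurable; apply/seteqP; split => w /= ->.
Qed.

Lemma past_measurable t A : past flip plus t A -> measurable A.
Proof.
apply: smallest_sub; first exact: sigma_algebra_measurable.
move=> B [s /andP[s0 _]] [->|->]; apply: measurable_bool.
  exact: (flip_measurable choices s0).
exact: (plus_measurable choices s0).
Qed.

(** The history up to time [t] is a function of the coins of the steps before
    [t + 1]. *)
Lemma past_event t (A : seq coins -> bool) :
  past flip plus t.+1 [set w | A (hist w t)].
Proof.
rewrite /past.
elim: t A => [|t IH] A.
  rewrite /=; case: (A [::]).
    have -> : [set _ : T | true] = [set: T] by apply/seteqP; split.
    exact: (@measurableT _ (g_sigma_algebraType _)).
  have -> : [set _ : T | false] = set0 by apply/seteqP; split.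
  exact: (@measurable0 _ (g_sigma_algebraType _)).
set G := [set A | _].
pose mG := @measurable _ (g_sigma_algebraType G).
have mono (B : seq coins -> bool) : mG [set w | B (hist w t)].
  apply: sub_sigma_algebra2 (IH B) => C [s /andP[s0 st] hC]; exists s => //.
  by rewrite s0 ltnW.
have mF : mG [set w | flip t.+1 w].
  by apply: sub_sigma_algebra; exists t.+1; [rewrite ltnSn | left].
have mP : mG [set w | plus t.+1 w].
  by apply: sub_sigma_algebra; exists t.+1; [rewrite ltnSn | right].
have -> : [set w | A (hist w t.+1)] =
  ([set w | flip t.+1 w] `&` (([set w | plus t.+1 w] `&` [set w | A ((true, true) :: hist w t)]) `|`
                             (~` [set w | plus t.+1 w] `&` [set w | A ((true, false) :: hist w t)]))) `|`
  (~` [set w | flip t.+1 w] `&` (([set w | plus t.+1 w] `&` [set w | A ((false, true) :: hist w t)]) `|`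
                             (~` [set w | plus t.+1 w] `&` [set w | A ((false, false) :: hist w t)]))).
  apply/seteqP; split => w /=; rewrite /coin_at.
    by case: (flip t.+1 w); case: (plus t.+1 w) => Aw; [left|left|right|right];
       split=> //; [left|right|left|right]; split.
  by move=> [[-> [[-> //]|[/negP/negbTE -> //]]]|[/negP/negbTE -> [[-> //]|[/negP/negbTE -> //]]]].
have mI := @measurableI _ (g_sigma_algebraType G).
have mU := @measurableU _ (g_sigma_algebraType G).
have mC := @measurableC _ (g_sigma_algebraType G).
have mA c : mG [set w | A (c :: hist w t)] := mono (fun h => A (c :: h)).
have mPA b b' : mG (([set w | plus t.+1 w] `&` [set w | A ((b, b') :: hist w t)]) `|`
    (~` [set w | plus t.+1 w] `&` [set w | A ((b, ~~ b') :: hist w t)])).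
  by apply: (mU); apply: (mI) => //; [exact: mA | exact: mC | exact: mA].
apply: (mU); apply: (mI) => //; [exact: (mPA true true) | exact: mC | exact: (mPA false true)].
Qed.

Lemma probaDI (A B : set T) : measurable A -> measurable B ->
  P A = (P (A `\` B) + P (A `&` B))%E.
Proof. exact: measureDI. Qed.

(** Independence from [B] passes to its complement. *)
Lemma proba_split (A B : set T) (p r : R) : measurable A -> measurable B ->
  P (B `&` A) = (p * r)%:E -> P A = r%:E -> P (~` B `&` A) = ((1 - p) * r)%:E.
Proof.
move=> mA mB hBA hA.
have := probaDI mA mB; rewrite hA setDE (setIC A (~` B)) (setIC A B) hBA.
have mC : measurable (~` B `&` A) by apply: measurableI => //; apply: measurableC.
rewrite -(fineK (fin_num_measure P _ mC)) -EFinD => -[e].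
by congr (_%:E); move: e; lra.
Qed.

Lemma proba_coin t (A : set T) (r : R) b c : past flip plus t.+1 A -> P A = r%:E ->
  P (([set w | flip t.+1 w = b] `&` [set w | plus t.+1 w = c]) `&` A) =
  ((if b then q else 1 - q) / 2 * r)%:E.
Proof.
move=> pA hA; have mA := past_measurable pA.
pose F := [set w | flip t.+1 w]; pose Q := [set w | plus t.+1 w].
have mF : measurable F by apply: measurable_bool; exact: (flip_measurable choices (ltn0Sn t)).
have mQ : measurable Q by apply: measurable_bool; exact: (plus_measurable choices (ltn0Sn t)).
pose G := past flip plus t.+1 `|` [set F].
pose mG := @measurable _ (g_sigma_algebraType G).
have GF : mG F by apply: sub_sigma_algebra; right.
have GA : mG A by apply: sub_sigma_algebra; left.
pose Fb := [set w | flip t.+1 w = b].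
have eFb : Fb = if b then F else ~` F.
  by rewrite /Fb /F; clear Fb; case: b; apply/seteqP; split => w /=; case: (flip _ w).
have eQc : [set w | plus t.+1 w = c] = if c then Q else ~` Q.
  by rewrite /Q; case: c; apply/seteqP; split => x /=; case: (plus _ x).
have hFA : P (F `&` A) = (q * r)%:E.
  by rewrite (flip_independent choices (ltn0Sn t) pA) hA (flip_proba choices (ltn0Sn t)).
have hFbA : P (Fb `&` A) = ((if b then q else 1 - q) * r)%:E.
  by rewrite eFb; case: ifP => _ //; apply: proba_split.
have GFbA : mG (Fb `&` A).
  apply: (@measurableI _ (g_sigma_algebraType G)) => //.
  by rewrite eFb; case: ifP => _ //; apply: (@measurableC _ (g_sigma_algebraType G)).
have mFbA : measurable (Fb `&` A).
  by apply: measurableI => //; rewrite eFb; case: ifP => _ //; apply: measurableC.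
have hQ : P (Q `&` (Fb `&` A)) = (2^-1 * ((if b then q else 1 - q) * r))%:E.
  by rewrite (plus_independent choices (ltn0Sn t) GFbA) hFbA (plus_proba choices (ltn0Sn t)).
rewrite eQc [_ `&` (if c then _ else _)]setIC -setIA -/Fb.
case: c {eQc}; first by rewrite hQ; congr (_%:E); ring.
by rewrite (proba_split mFbA mQ hQ hFbA); congr (_%:E); field.
Qed.

(** Splitting on the two coins of the last step turns the independence
    assumptions into the recursion that defines [expect]. *)
Lemma proba_hist t (A : seq coins -> bool) :
  P [set w | A (hist w t)] = (expect q t (fun h => (A h)%:R))%:E.
Proof.
elim: t A => [|t IH] A.
  rewrite /=; case: (A [::]).
    by have -> : [set _ : T | true] = [set: T]; [apply/seteqP; split | rewrite probability_setT].
  by have -> : [set _ : T | false] = set0; [apply/seteqP; split | rewrite measure0].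
pose piece b c := ([set w | flip t.+1 w = b] `&` [set w | plus t.+1 w = c]) `&`
   [set w | A ((b, c) :: hist w t)].
have hp b c : P (piece b c) = ((if b then q else 1 - q) / 2 *
    expect q t (fun h => (A ((b, c) :: h))%:R))%:E.
  pose A' h := A ((b, c) :: h).
  exact: (proba_coin b c (past_event A') (IH A')).
set Y := [set w | _].
have mY : measurable Y := past_measurable (past_event (t := t.+1) A).
have mF : measurable [set w | flip t.+1 w].
  by apply: measurable_bool; exact: (flip_measurable choices (ltn0Sn t)).
have mQ : measurable [set w | plus t.+1 w].
  by apply: measurable_bool; exact: (plus_measurable choices (ltn0Sn t)).
rewrite (probaDI mY mF) (probaDI (measurableD mY mF) mQ).
rewrite (probaDI (measurableI _ _ mY mF) mQ).
have e b c : piece b c = Y `&` [set w | flip t.+1 w = b] `&` [set w | plus t.+1 w = c].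
  apply/seteqP; split => w; rewrite /piece /Y /= /coin_at.
    by move=> [[<- <-] Aw].
  by move=> [[Aw <-] <-].
have -> : Y `&` [set w | flip t.+1 w] `&` [set w | plus t.+1 w] = piece true true by rewrite e.
have -> : (Y `&` [set w | flip t.+1 w]) `\` [set w | plus t.+1 w] = piece true false.
  by rewrite e setDE; congr (_ `&` _); apply/seteqP; split => w /=; case: (plus _ w).
have -> : (Y `\` [set w | flip t.+1 w]) `&` [set w | plus t.+1 w] = piece false true.
  by rewrite e setDE; congr (_ `&` _ `&` _); apply/seteqP; split => w /=; case: (flip _ w).
have -> : (Y `\` [set w | flip t.+1 w]) `\` [set w | plus t.+1 w] = piece false false.
  rewrite e !setDE; congr (_ `&` _ `&` _); apply/seteqP; split => w /=.
  - by case: (flip _ w).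
  - by case: (flip _ w).
  - by case: (plus _ w).
  - by case: (plus _ w).
rewrite !hp -!EFinD; congr (_%:E) => /=.
rewrite /mean.
have -> : (fun h : seq coins =>
    q * (((A ((true, true) :: h))%:R + (A ((true, false) :: h))%:R) / 2) +
    (1 - q) * (((A ((false, true) :: h))%:R + (A ((false, false) :: h))%:R) / 2)) =
  (fun h => (q / 2 * (A ((true, true) :: h))%:R + q / 2 * (A ((true, false) :: h))%:R) +
    ((1 - q) / 2 * (A ((false, true) :: h))%:R + (1 - q) / 2 * (A ((false, false) :: h))%:R)) :> (_ -> R).
  by apply/funext => h; ring.
rewrite !expectD !expectZ; ring.
Qed.

End Histories.

(** * From departures to entries *)

Lemma unbounded_infinite (A : set nat) :
  (forall s, exists2 t, (s <= t)%N & A t) -> infinite_set A.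
Proof.
move=> hA /finite_seqP[l el].
have [t lt At] := hA (\max_(x <- l) x).+1.
have tl : t \in l by move: At; rewrite el.
by have := @leq_bigmax_seq _ l xpredT id t tl isT; rewrite leqNgt lt.
Qed.

Section Entries.
Variables (n : nat) (rho : vertex -> label) (f p : nat -> bool) (v : vertex).
Hypothesis n0 : (0 < n)%N.
Local Notation walk := (hv_walk n rho f p).

(** Between two moves of a walker only the other walkers move. *)
Lemma position_between_moves u j : (j < n)%N ->
  position (walk (u.+1 + j)%N) (mover n u.+1) = position (walk u.+1) (mover n u.+1).
Proof.
elim: j => [|j IH] jn; first by rewrite addn0.
have ne : (u %% n == (u.+1 + j) %% n)%N = false.
  by rewrite -{1}[u]addn0 addSnnS eqn_modDl mod0n modn_small.
by rewrite addnS -IH ?(ltnW jn) // [in LHS]/= /step /= /mover /= eqSS ne.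
Qed.

(** The mover of step [t + 1] arrived at its present position at its previous
    move, [n] steps earlier. *)
Lemma departure_entry t : (n <= t)%N ->
  position (walk t) (mover n t.+1) = v ->
  entry_times n rho f p v (t.+1 - n)%N.
Proof.
move=> nt ev; split; first by rewrite subn_gt0 ltnS.
have e : (t.+1 - n = (t - n).+1)%N by rewrite subSn.
have em : mover n t.+1 = mover n (t - n).+1.
  by rewrite /mover /= -[in LHS](subnK nt) modnDr.
rewrite e -em -[RHS]ev em -[LHS](@position_between_moves (t - n) n.-1) ?ltn_predL //.
by congr (position (walk _) _); lia.
Qed.

End Entries.

Section Recurrence.
Context {d : measure_display} {T : measurableType d} {R : realType}.
Variables (P : probability T R) (q : R) (n : nat) (rho : vertex -> label).
Variables (flip plus : nat -> T -> bool).
Hypothesis choices : hv_choices P q flip plus.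
Hypothesis n0 : (0 < n)%N.
Hypothesis hq : 0 < q <= 1.
Hypothesis hn : `|4 * q - 2| / q < n%:R.

Local Notation hist := (hist flip plus).

Definition silent (v : vertex) (s : nat) : set T :=
  [set w | forall t, (s <= t)%N -> next_site n rho (hist w t) != v].

Lemma silent_quiet v s w k : silent v s w -> exists2 h, size h = k &
  hist w (k + s) = h ++ hist w s /\ quiet n rho v h (hist w s).
Proof.
move=> sw; elim: k => [|k [h sh [eh qh]]]; first by exists [::].
exists (coin_at flip plus (k + s).+1 w :: h); first by rewrite /= sh.
by rewrite addSn /= qh -eh sw // leq_addl.
Qed.

(** The event lies in events of probability at most [y ^ m], for every [m], each
    of which depends on finitely many coins only. *)
Lemma silent_negligible v s : P.-negligible (silent v s).
Proof.
have [y /andP[y0 y1] hy] := quiet_iter rho v n0 hq hn.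
have [k hk] := choice (fun m => hy m s).
pose A m h := quiet n rho v (take (k m) h) (drop (k m) h).
pose E m := [set w | A m (hist w (k m + s))].
have mE m : measurable (E m) := past_measurable choices (past_event (A m)).
have PE m : (P (E m) <= (y ^+ m)%:E)%E.
  rewrite (proba_hist choices) lee_fin expect_cat.
  rewrite -[leRHS](expect_cst q s); apply: le_expect => [|h0 sh0].
    by case/andP: hq => /ltW -> ->.
  apply: le_trans (hk m h0 sh0); apply: le_expect => [|h sh].
    by case/andP: hq => /ltW -> ->.
  by rewrite /A take_size_cat // drop_size_cat.
exists (\bigcap_m E m); split.
- exact: bigcap_measurable.
- have mI : measurable (\bigcap_m E m) by apply: bigcap_measurable.
  have le m : (P (\bigcap_m E m) <= (y ^+ m)%:E)%E.
    apply: le_trans (PE m); apply: le_measure; rewrite ?inE //.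
    exact: bigcap_inf.
  have fP := fineK (fin_num_measure P _ mI).
  rewrite -fP; congr (_%:E); apply/eqP; rewrite eq_le fine_ge0 ?andbT; last exact: measure_ge0.
  apply: contraT; rewrite -ltNge => x0.
  have y1' : `|y| < 1 by rewrite ger0_norm.
  have [m _ hm] := cvgr_lt 0 (cvg_expr y1') _ x0.
  have := hm m (leqnn m); rewrite ltNge /= => /negP; case.
  by rewrite -lee_fin fP.
- move=> w sw m _; have [h sh [eh qh]] := silent_quiet (k m) sw.
  by rewrite /E /A /= eh take_size_cat // drop_size_cat.
Qed.

Lemma entries_infinite v :
  {ae P, forall w, infinite_set (entry_times n rho (flip^~ w) (plus^~ w) v)}.
Proof.
apply: (@negligibleS _ _ _ _ (\bigcup_s silent v s)); last first.
  by apply: negligible_bigcup => s; apply: silent_negligible.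
move=> w /= fin; apply: contrapT => nosilent; apply: fin.
apply: unbounded_infinite => s.
have : ~ silent v (s + n) w by move=> h; apply: nosilent; exists (s + n)%N.
move=> /existsNP[t /not_implyP[st /negP/negPn/eqP ev]].
exists (t.+1 - n)%N; first by lia.
apply: departure_entry => //; first by lia.
by rewrite -run_hist -[in RHS]ev /next_site size_hist.
Qed.

End Recurrence.

Theorem theorem1p1 (R : realType) (q : R) (n : nat)
    (hq : 0 < q <= 1)
    (hn : Num.floor (`|4 * q - 2| / q) + 1 <= n%:Z)
    (rho : vertex -> label)
    (d : measure_display) (T : measurableType d) (P : probability T R)
    (flip plus : nat -> T -> bool)
    (hwalk : hv_choices P q flip plus) :
  hv_recurrent P n rho flip plus.
Proof.
have hn' : `|4 * q - 2| / q < n%:R.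
  by rewrite [n%:R]pmulrn -floor_lt_int; rewrite lezD1 in hn.
(* The critical number is nonnegative, so there is at least one walker. *)
have n0 : (0 < n)%N.
  rewrite -(ltr0n R); apply: le_lt_trans hn'.
  by rewrite divr_ge0 //; case/andP: hq => /ltW.
(* Vertices are enumerated by naturals, to take a countable intersection. *)
have all_v (k : nat) : {ae P, forall w, forall v, pickle v = k ->
    infinite_set (entry_times n rho (flip^~ w) (plus^~ w) v)}.
  case e : (unpickle k : option vertex) => [v|].
    apply: filterS (entries_infinite rho hwalk n0 hq hn' v) => w hw u eu.
    by move: e; rewrite -eu pickleK => -[->].
  by apply: filterE => w u eu; move: e; rewrite -eu pickleK.
apply: filterS (ae_foralln all_v) => w hw v; exact: hw.
Qed.
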